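(* Let $0<q<\infty$, $\gamma>0$, $\alpha>-1$ and let $\mu$ be a positive Borel measure on $[0,1)$. (i) $D_\alpha F_\mu\in H(\infty,1,\gamma)$ if and only if $((n+1)^{\alpha-\gamma}\mu_n)_{n\ge0}\in\ell^1$. (ii) $D_\alpha F_\mu\in H(\infty,q,\gamma)$ if and only if $((n+1)^{\alpha-\gamma+1-1/q}\mu_n)_{n\ge0}\in\ell^q$. (iii) Let $1\le p<\infty$, $1/p'=1-1/p$, and $-1<\alpha<\gamma$. Then the following are equivalent: (a) $D_\alpha F_\mu\in H(p,q,\gamma)$. (b) $(\mu_n(n+1)^{-2/p+(\alpha-\gamma+1)})_{n\ge0}\in\ell(p,q)$. (c) $((n+1)^{\alpha-\gamma+1/p'-1/q}\mu_n)_{n\ge0}\in\ell^q$.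
   Context: $\mathbb D$ is the open unit disc of $\mathbb C$ and $\mathcal H(\mathbb D)$ the space of analytic functions on $\mathbb D$. Positive Borel measures on $[0,1)$ are understood to be finite. Put $\mu_n=\int_0^1t^n\,d\mu(t)$ and $F_\mu(z)=\sum_{n=0}^\infty\mu_nz^n=\int_0^1\frac{d\mu(t)}{1-tz}$. For $\alpha>-1$ and $f(z)=\sum_{n\ge0} a_nz^n\in\mathcal H(\mathbb D)$, the fractional derivative is $D_\alpha f(z)=\sum_{n=0}^\infty\frac{\Gamma(n+\alpha+1)}{n!\,\Gamma(\alpha+1)}a_nz^n$. For $f\in\mathcal H(\mathbb D)$ and $0<r<1$: $M_p(f,r)=\left(\int_0^{2\pi}|f(re^{i\theta})|^p\frac{d\theta}{2\pi}\right)^{1/p}$ for $0<p<\infty$, and $M_\infty(f,r)=\max_{|z|=r}|f(z)|$. For $0<p\le\infty$, $0<q<\infty$, $\gamma>0$, $H(p,q,\gamma)$ is the space of $f\in\mathcal H(\mathbb D)$ with $\int_0^1(1-r)^{\gamma q-1}M_p^q(f,r)\,dr<\infty$. For $0<q<\infty$, $\ell^q$ is the space of sequences with $\sum_n|x_n|^q<\infty$. For $0<p,q<\infty$, the Kellogg space $\ell(p,q)$ is the space of complex sequences $(a_k)_{k\ge0}$ with $\left(\sum_{n=0}^\infty\left(\sum_{k\in I_n}|a_k|^p\right)^{q/p}\right)^{1/q}<\infty$, where $I_0=\{0\}$ and $I_n=[2^{n-1},2^n)\cap\mathbb N$ for $n\ge1$. *)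

(* Defs.v *)
From HB Require Import structures.
From mathcomp Require Import all_boot all_order all_algebra.
From mathcomp Require Import complex.
From mathcomp Require Import all_classical all_reals all_analysis.

Set Implicit Arguments.
Unset Strict Implicit.
Unset Printing Implicit Defensive.

Import Order.TTheory GRing.Theory Num.Theory.
Import numFieldNormedType.Exports.

Local Open Scope classical_set_scope.
Local Open Scope ring_scope.
Local Open Scope complex_scope.

(* Functions on the disc are total functions on [R[i]^o], the complex numbers  *)
(* seen as a normed space over themselves; only their values on the disc       *)
(* matter.                                                                     *)

(* Real-valued modulus: the ring norm [`|z|] of [R[i]] takes values in [R[i]]. *)
Definition cabs (R : realType) (z : R[i]) : R := ComplexField.Normc.normc z.

Definition analytic_on_disc (R : realType) (f : R[i]^o -> R[i]^o) : Prop :=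
  forall z : R[i]^o, cabs z < 1 -> derivable f z 1.

Definition taylor_coef (R : realType) (f : R[i]^o -> R[i]^o) (n : nat) : R[i]^o :=
  derive1n n f 0 / n`!%:R.

Definition power_series (R : realType) (a : nat -> R[i]) (z : R[i]^o) : R[i]^o :=
  limn (series (fun n => a n * z ^+ n : R[i]^o)).

Definition Gamma (R : realType) (s : R) : R :=
  \int[lebesgue_measure]_(t in `]0, +oo[) (t `^ (s - 1) * expR (- t)).

Definition frac_deriv (R : realType) (alpha : R) (f : R[i]^o -> R[i]^o) :
    R[i]^o -> R[i]^o :=
  power_series (fun n =>
    (Gamma (n%:R + alpha + 1) / (n`!%:R * Gamma (alpha + 1)))%:C
      * taylor_coef f n).

Definition moment (R : realType)
    (mu : {finite_measure set (measurableTypeR R) -> \bar R}) (n : nat) : R :=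
  \int[mu]_(t in `[0, 1[) t ^+ n.

Definition F_mu (R : realType)
    (mu : {finite_measure set (measurableTypeR R) -> \bar R}) : R[i]^o -> R[i]^o :=
  power_series (fun n => (moment mu n)%:C).

Definition circle_pt (R : realType) (r theta : R) : R[i] :=
  r%:C * (cos theta +i* sin theta).

(* The value at [p = -oo] is junk. For f continuous on the circle, the         *)
(* supremum in the case [p = +oo] is the maximum.                              *)
Definition M_ (R : realType) (p : \bar R) (f : R[i]^o -> R[i]^o) (r : R) : \bar R :=
  match p with
  | p'%:E => ((\int[lebesgue_measure]_(theta in `[0%R, (2 * pi)%R])
                (cabs (f (circle_pt r theta)) `^ p' / (2 * pi))%:E) `^ p'^-1)%E
  | +oo%E => ereal_sup [set (cabs (f z))%:E | z in [set z : R[i]^o | cabs z = r]]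
  | -oo%E => 0%E
  end.

Definition H_space (R : realType) (p : \bar R) (q gamma : R) :
    set (R[i]^o -> R[i]^o) :=
  [set f | analytic_on_disc f /\
    (\int[lebesgue_measure]_(r in `]0%R, 1%R[)
       (((1 - r) `^ (gamma * q - 1))%:E * M_ p f r `^ q) < +oo)%E].

Definition ell (R : realType) (q : R) : set (nat -> R[i]) :=
  [set x | (\sum_(0 <= n <oo) (cabs (x n) `^ q)%:E < +oo)%E].

(* The block I_n is [kellogg_lo n, 2 ^ n).                                     *)
Definition kellogg_lo (n : nat) : nat := if n is m.+1 then (2 ^ m)%N else 0%N.

Definition kellogg (R : realType) (p q : R) : set (nat -> R[i]) :=
  [set a | ((\sum_(0 <= n <oo)
     ((\sum_(kellogg_lo n <= k < 2 ^ n) cabs (a k) `^ p) `^ (q / p))%:E) `^ q^-1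
       < +oo)%E].

(* Main.v *)
Require Import Defs.
From HB Require Import structures.
From mathcomp Require Import all_boot all_order all_algebra.
From mathcomp Require Import ring lra.
From mathcomp Require Import complex.
From mathcomp Require Import all_classical all_reals all_analysis.
From mathcomp Require Import measurable_realfun.

Set Implicit Arguments.
Unset Strict Implicit.
Unset Printing Implicit Defensive.

Import Order.TTheory GRing.Theory Num.Theory.
Import numFieldNormedType.Exports.

Local Open Scope classical_set_scope.
Local Open Scope ring_scope.
Local Open Scope complex_scope.

(* Put c_n = Gamma(n + alpha + 1) / (n! Gamma(alpha + 1)), so that
   f = D_alpha F_mu = sum_n c_n mu_n z^n is the integral of G(t z) dmu(t), where
   G(z) = sum_n c_n z^n has modulus |1 - z|^-(1 + alpha). Every condition of the
   theorem is compared with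
     sum_n 2^(n e) mu_(2^n)^q < oo
   for a suitable exponent e. For the sequence spaces this is monotonicity of mu_n.
   On the radii r_n = 1 - 2^-n, the estimate c_n ~ (n + 1)^alpha and a discrete Hardy
   inequality show that sum_n 2^(- n g q) f(r_n)^q < oo holds exactly for
   e = (alpha + 1 - g) q.
   As the coefficients are nonnegative, M_oo(f, r) = f(r), which settles (i) and (ii)
   with g = gamma. For (iii) one takes g = gamma + 1/p. On the one hand
   |f(r e^(i theta))| >= f(r) / 2 for |theta| <= c (1 - r), because
   cos >= 1 - theta^2 / 2 and sum n^2 c_n mu_n r^n <= C (1 - r)^-2 f(r). On the other
   hand |1 - t z| >= (1 - t (1 - m)) / 8, with pi m the distance from the argument of
   z to 2 pi Z, gives |f(z)| <= C f(1 - m); hence M_p(f, r)^p is at most a constant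
   times sum_(k <= n + 1) 2^-k f(r_(k+1))^p when r <= r_(n+1), and Hardy's inequality
   applies again. *)

(** * Bounded partial sums and dyadic blocks *)

(** The exponent [gamma + 1/p] in (iii) comes from the peak of [f] at argument 0: [|f|] is
    comparable to [f(r)] on an arc of length about [1 - r], and this arc alone contributes about
    [(1 - r)^(1/p) f(r)] to [M_p(f, r)]. The upper bound shows that in the weighted dyadic sums the
    rest of the circle adds nothing of larger order. Three choices shape the proof. All that is used
    about the coefficients is [c_0 = 1] and [(n + 1) c_(n+1) = (n + alpha + 1) c_n]; their growth,
    the moment bounds and the modulus of [G] follow from this recursion, without Stirling's formula
    and without a branch of a complex power. The function sending [r] to [M_p(f, r)] is never shown
    to be measurable: its integral is compared with those of functions constant on dyadic shells, by
    a monotonicity that asks for no measurability. Convergence of nonnegative series is expressed by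
    [bounded_psums], a real bound on all partial sums, so that comparisons, index shifts and Hardy's
    inequality are statements about finite real sums. *)

Definition bounded_psums (R : realType) (u : nat -> R) : Prop :=
  exists M, forall N, \sum_(0 <= n < N) u n <= M.

Section BoundedPartialSums.
Context {R : realType}.
Implicit Types (u v b : nat -> R).

Lemma le_bounded_psums u v (C : R) : 0 <= C -> (forall n, u n <= C * v n) ->
  bounded_psums v -> bounded_psums u.
Proof.
move=> C0 uv [M vM]; exists (C * M) => N.
apply: (le_trans (ler_sum_nat _)) => [n _|]; first exact: uv.
by rewrite -mulr_sumr ler_wpM2l.
Qed.

Lemma bounded_psums_shift u : bounded_psums (fun n => u n.+1) <-> bounded_psums u.
Proof.
split=> [[M uM]|[M uM]].
  exists (Num.max 0 (u 0%N + M)) => -[|N].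
    by rewrite big_geq// le_max lexx.
  by rewrite big_nat_recl// le_max lerD2l uM orbT.
exists (M - u 0%N) => N.
by rewrite lerBrDl; have := uM N.+1; rewrite big_nat_recl.
Qed.

Lemma bounded_psums_shiftn k u :
  bounded_psums (fun n => u (n + k)%N) <-> bounded_psums u.
Proof.
elim: k u => [|k IH] u.
  by have -> : (fun n => u (n + 0)%N) = u by apply: funext => n; rewrite addn0.
rewrite -(bounded_psums_shift u) -(IH (fun n => u n.+1)).
have -> // : (fun n => u (n + k.+1)%N) = (fun n => u (n + k).+1).
by apply: funext => n; rewrite addnS.
Qed.

Lemma powR_exprAC (a e : R) n : 0 <= a -> (a ^+ n) `^ e = (a `^ e) ^+ n.
Proof.
by move=> a0; rewrite -[a ^+ n]powR_mulrn// -powRrM mulrC powRrM powR_mulrn ?powR_ge0.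
Qed.

(** No distinction between [s <= 1] and [s >= 1] is needed: either [y <= (k - 1) x], so that
    [x + y <= k x], or [x < y / (k - 1)], so that [x + y <= k / (k - 1) y]. The factor of [x ^ s]
    can be made as close to 1 as desired. *)
Lemma powR_add_le (x y s k : R) : 0 <= x -> 0 <= y -> 0 < s -> 1 < k ->
  (x + y) `^ s <= k `^ s * x `^ s + (k / (k - 1)) `^ s * y `^ s.
Proof.
move=> x0 y0 s0 k1.
have km : 0 < k - 1 by rewrite subr_gt0.
have k0 : 0 <= k by lra.
have kk : 0 <= k / (k - 1) by apply: divr_ge0 => //; exact: ltW.
rewrite -!powRM//.
have [yx|xy] := leP y ((k - 1) * x).
  apply: ler_wpDr; first exact: powR_ge0.
  apply: ge0_ler_powR; rewrite ?nnegrE ?mulr_ge0 ?addr_ge0 ?(ltW s0)//; lra.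
apply: ler_wpDl; first exact: powR_ge0.
apply: ge0_ler_powR; rewrite ?nnegrE ?(mulr_ge0 kk) ?addr_ge0 ?(ltW s0)//.
rewrite mulrAC ler_pdivlMr// -subr_ge0.
have -> : k * y - (x + y) * (k - 1) = y - (k - 1) * x by ring.
by rewrite subr_ge0 ltW.
Qed.

(* With k ^ s = l ^ (- 1 / 2) in powR_add_le, T_n = l ^ n * (b_0 + ... + b_n) ^ s
   satisfies T_n <= l ^ (1 / 2) * T_(n-1) + C * l ^ n * b_n ^ s; summing over n
   gives the result for every s > 0 at once. *)
Lemma discrete_hardy (l s : R) b : 0 < l < 1 -> 0 < s -> (forall n, 0 <= b n) ->
  bounded_psums (fun n => l ^+ n * b n `^ s) ->
  bounded_psums (fun n => l ^+ n * (\sum_(0 <= k < n.+1) b k) `^ s).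
Proof.
move=> /andP[l0 l1] s0 b0 [M bM].
pose k := l `^ (- (2 * s)^-1).
have k1 : 1 < k.
  rewrite /k -[X in X < _](powRr0 l) /powR gt_eqF// ltr_expR mul0r mulNr.
  rewrite oppr_gt0 pmulr_rlt0 ?invr_gt0 ?mulr_gt0//.
  by apply: ln_lt0; rewrite l0 l1.
have kl : k `^ s * l = l `^ (2^-1).
  rewrite /k -powRrM -[X in _ * X](powRr1 (ltW l0)) -powRD ?(gt_eqF l0) ?implybT//.
  by congr (_ `^ _); field; rewrite gt_eqF.
have l2 : l `^ 2^-1 < 1.
  rewrite -[ltRHS](powRr0 l) /powR gt_eqF// ltr_expR mul0r.
  by rewrite pmulr_rlt0 ?invr_gt0//; apply: ln_lt0; rewrite l0 l1.
set C := (k / (k - 1)) `^ s.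
pose B n := \sum_(0 <= i < n.+1) b i.
have B0 n : 0 <= B n by apply: sumr_ge0.
(* The term [n = 0] has no predecessor; there [b 0 ^ s] is compared with [C] times itself. *)
have C1 : 1 <= C.
  suff : 1 `^ s <= C by rewrite powR1.
  apply: ge0_ler_powR; rewrite ?nnegrE ?(ltW s0)//.
    by rewrite divr_ge0//; lra.
  by rewrite ler_pdivlMr; lra.
have step N : \sum_(0 <= n < N) l ^+ n * B n `^ s <=
    l `^ 2^-1 * (\sum_(0 <= n < N) l ^+ n * B n `^ s) +
    C * (\sum_(0 <= n < N) l ^+ n * b n `^ s).
  case: N => [|N]; first by rewrite !big_geq// !mulr0 addr0.
  rewrite [leLHS]big_nat_recl//= expr0 mul1r.
  rewrite [in X in _ <= _ + X]big_nat_recl//= expr0 mul1r mulrDr addrCA.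
  rewrite lerD//.
    by rewrite {1}/B big_nat1 ler_peMl ?powR_ge0.
  rewrite [in X in _ <= X + _]big_nat_recr//= mulrDr -addrA addrCA.
  apply: ler_wpDl; first by rewrite !mulr_ge0 ?powR_ge0 ?exprn_ge0 ?(ltW l0).
  rewrite !mulr_sumr -big_split/=; apply: ler_sum_nat => n _.
  rewrite {1}/B big_nat_recr//= -/(B n).
  apply: (le_trans (ler_wpM2l _ (powR_add_le (B0 n) (b0 _) s0 k1))).
    by rewrite exprn_ge0// ltW.
  rewrite mulrDr -/C -kl exprSr; rewrite le_eqVlt; apply/orP; left; apply/eqP.
  by ring.
exists ((1 - l `^ 2^-1)^-1 * (C * M)) => N.
rewrite ler_pdivlMl; last by rewrite subr_gt0.
rewrite mulrBl mul1r lerBlDl (le_trans (step N))// lerD2l ler_wpM2l//; lra.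
Qed.

End BoundedPartialSums.

(** * Dyadic comparison for decreasing sequences *)

Section DyadicBlocks.
Context {R : realType}.
Implicit Types (mu w a : nat -> R).

(** The bounds are symmetric in the sign of [e], so increasing and decreasing powers need no
    separate treatment. *)
Lemma powR_half_two (x e : R) : 2^-1 <= x <= 2 ->
  2 `^ (- `|e|) <= x `^ e <= 2 `^ `|e|.
Proof.
move=> /andP[x1 x2]; have x0 : 0 < x by apply: lt_le_trans x1; rewrite invr_gt0.
have lx : `|ln x| <= ln 2.
  rewrite ler_norml -lnV ?posrE// !ler_ln ?posrE ?invr_gt0//.
  by rewrite x1 x2.
rewrite /powR !gt_eqF// !ler_expR mulNr -ler_norml normrM.
by rewrite ler_wpM2l.
Qed.

Lemma powR_dyadic m (x e : R) : 2 ^+ m <= x <= 2 ^+ m.+1 ->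
  2 `^ (- `|e|) * (2 `^ e) ^+ m <= x `^ e <= 2 `^ `|e| * (2 `^ e) ^+ m.
Proof.
have m0 : 0 < 2 ^+ m :> R by rewrite exprn_gt0.
move=> /andP[x1 x2]; have x0 : 0 < x by exact: lt_le_trans x1.
have -> : x = x / 2 ^+ m * 2 ^+ m by rewrite mulfVK ?gt_eqF.
rewrite powRM ?divr_ge0 ?(ltW x0) ?(ltW m0)// powR_exprAC//.
rewrite !ler_pM2r ?exprn_gt0 ?powR_gt0//; apply: powR_half_two.
rewrite ler_pdivlMr// ler_pdivrMr// -exprS x2 andbT.
by apply: le_trans x1; rewrite ler_piMl ?(ltW m0)// invf_le1 ?ler1n.
Qed.

Lemma natr_dyadic k m : (2 ^ m <= k < 2 ^ m.+1)%N ->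
  2 ^+ m <= (k.+1%:R : R) <= 2 ^+ m.+1.
Proof.
by move=> /andP[k1 k2]; rewrite -!natrX !ler_nat k2 andbT (leq_trans k1).
Qed.

Lemma block_size m : (2 ^ m.+1 - 2 ^ m = 2 ^ m)%N.
Proof. by rewrite expnS mul2n -addnn addnK. Qed.

(** The block has [2 ^ m] terms, each weight is at most a constant times [2 ^ (m b)], and [mu] is
    largest at the left end; the number of terms accounts for the 1 in [b + 1]. *)
Lemma block_sum_le mu w (b K : R) m : 0 <= K ->
  (forall n, 0 <= mu n) -> {homo mu : n k / (n <= k)%N >-> k <= n} ->
  (forall n, 0 <= w n <= K * n.+1%:R `^ b) ->
  \sum_(2 ^ m <= k < 2 ^ m.+1) w k * mu k <=
    K * 2 `^ `|b| * ((2 `^ (b + 1)) ^+ m * mu (2 ^ m)%N).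
Proof.
move=> K0 mu0 mud wK.
apply: (@le_trans _ _ (\sum_(2 ^ m <= k < 2 ^ m.+1)
    K * (2 `^ `|b| * (2 `^ b) ^+ m) * mu (2 ^ m)%N)).
  apply: ler_sum_nat => k mk.
  have /andP[w0 wk] := wK k.
  rewrite ler_pM ?mud//; last by case/andP: mk.
  apply: (le_trans wk); rewrite ler_wpM2l//.
  by have /andP[] := powR_dyadic b (natr_dyadic mk).
rewrite big_const_nat iter_addr_0 block_size -(mulr_natr _ (2 ^ m)) natrX.
rewrite powRD ?pnatr_eq0 ?implybT// powRr1// exprMn.
by rewrite le_eqVlt; apply/orP; left; apply/eqP; ring.
Qed.

(** The lower bound takes [mu] at [2 ^ m.+1], the start of the next block, so the two block
    estimates together lose one dyadic index. *)
Lemma block_sum_ge mu w (b K : R) m : 0 <= K ->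
  (forall n, 0 <= mu n) -> {homo mu : n k / (n <= k)%N >-> k <= n} ->
  (forall n, K * n.+1%:R `^ b <= w n) ->
  K * 2 `^ (- `|b|) * ((2 `^ (b + 1)) ^+ m * mu (2 ^ m.+1)%N) <=
    \sum_(2 ^ m <= k < 2 ^ m.+1) w k * mu k.
Proof.
move=> K0 mu0 mud wK.
apply: (@le_trans _ _ (\sum_(2 ^ m <= k < 2 ^ m.+1)
    K * (2 `^ (- `|b|) * (2 `^ b) ^+ m) * mu (2 ^ m.+1)%N)).
  rewrite big_const_nat iter_addr_0 block_size -(mulr_natr _ (2 ^ m)) natrX.
  rewrite powRD ?pnatr_eq0 ?implybT// powRr1// exprMn.
  by rewrite le_eqVlt; apply/orP; left; apply/eqP; ring.
apply: ler_sum_nat => k mk.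
rewrite ler_pM ?mulr_ge0 ?exprn_ge0 ?powR_ge0 ?mud//; last first.
  by case/andP: mk => _ /ltnW.
apply: le_trans (wK k); rewrite ler_wpM2l//.
by have /andP[] := powR_dyadic b (natr_dyadic mk).
Qed.

Lemma sum_kellogg_blocks a n :
  \sum_(0 <= j < n.+1) \sum_(kellogg_lo j <= k < 2 ^ j) a k =
  \sum_(0 <= k < 2 ^ n) a k.
Proof.
elim: n => [|n IH]; first by rewrite big_nat1.
by rewrite big_nat_recr//= IH -big_cat_nat// leq_exp2l.
Qed.

(** For [nu = mu ^ p], again decreasing, the block sum is comparable to
    [2 ^ (m (e p + 1)) nu(2 ^ m)] up to a shift of one index; the power [q / p] turns [e p + 1] into
    [(e + 1/p) q]. *)
Lemma kellogg_psums mu (e p q : R) : 0 < p -> 0 < q ->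
  (forall n, 0 <= mu n) -> {homo mu : n k / (n <= k)%N >-> k <= n} ->
  bounded_psums (fun n =>
    (\sum_(kellogg_lo n <= k < 2 ^ n) (mu k * k.+1%:R `^ e) `^ p) `^ (q / p)) <->
  bounded_psums (fun n => (2 `^ ((e + p^-1) * q)) ^+ n * mu (2 ^ n)%N `^ q).
Proof.
move=> p0 q0 mu0 mud.
have qp0 : 0 < q / p by rewrite divr_gt0.
pose nu n := mu n `^ p.
have nu0 n : 0 <= nu n by exact: powR_ge0.
have nud : {homo nu : n k / (n <= k)%N >-> k <= n}.
  by move=> n k nk; apply: ge0_ler_powR; rewrite ?nnegrE ?mud// ltW.
have aE k : (mu k * k.+1%:R `^ e) `^ p = k.+1%:R `^ (e * p) * nu k.
  by rewrite powRM ?powR_ge0// -powRrM mulrC.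
have E (K : R) m n : 0 <= K ->
    (K * ((2 `^ (e * p + 1)) ^+ m * nu n)) `^ (q / p) =
    K `^ (q / p) * ((2 `^ ((e + p^-1) * q)) ^+ m * mu n `^ q).
  move=> K0; rewrite powRM ?mulr_ge0 ?exprn_ge0 ?powR_ge0//; congr (_ * _).
  rewrite powRM ?exprn_ge0 ?powR_ge0// powR_exprAC ?powR_ge0// -!powRrM.
  by congr ((_ `^ _) ^+ _ * _ `^ _); field; rewrite gt_eqF.
have Kge0 (x : R) : 0 <= 1 * 2 `^ x by rewrite mul1r powR_ge0.
(* Block [m + 1] is [[2^m, 2^(m+1))], so the block sums are shifted by one index, which drops the
   exceptional block [{0}]. *)
split=> H; apply/bounded_psums_shift.
  move: ((bounded_psums_shift _).2 H).
  set b : R := e * p.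
  apply: (@le_bounded_psums _ _ _
    (2 `^ ((e + p^-1) * q) * ((1 * 2 `^ (- `|b|)) `^ (q / p))^-1)).
    by rewrite mulr_ge0 ?invr_ge0 ?powR_ge0.
  move=> m; rewrite exprS -!mulrA ler_wpM2l ?powR_ge0// ler_pdivlMl; last first.
    by rewrite !powR_gt0// mul1r powR_gt0.
  rewrite -E//.
  apply: ge0_ler_powR; rewrite ?nnegrE ?(ltW qp0)//.
  - by rewrite !mulr_ge0 ?exprn_ge0 ?powR_ge0.
  - by apply: sumr_ge0 => k _; exact: powR_ge0.
  under eq_bigr do rewrite aE.
  by apply: block_sum_ge => // n; rewrite mul1r.
move: H; set b : R := e * p.
apply: (@le_bounded_psums _ _ _ ((1 * 2 `^ (`|b|)) `^ (q / p))).
  exact: powR_ge0.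
move=> m; rewrite -E//.
apply: ge0_ler_powR; rewrite ?nnegrE ?(ltW qp0)//.
- by apply: sumr_ge0 => k _; exact: powR_ge0.
- by rewrite !mulr_ge0 ?exprn_ge0 ?powR_ge0.
under eq_bigr do rewrite aE.
by apply: block_sum_le => // n; rewrite mul1r powR_ge0 lexx.
Qed.

(** Since [(1 - h/2)^2 >= 1 - h], the numbers [(1 - 2^-n)^(2^n)] increase with [n], starting from
    [1/4] at [n = 1]. *)
Lemma dyadic_radius_exp m k : (k < 2 ^ m.+1)%N ->
  4^-1 <= (1 - 2^-1 ^+ m.+1 : R) ^+ k.
Proof.
move=> km; have h0 n : 0 < 2^-1 ^+ n :> R by rewrite exprn_gt0// invr_gt0.
have h1 n : 2^-1 ^+ n <= 1 :> R by rewrite exprn_ile1// invf_le1// ler1n.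
apply: (@le_trans _ _ ((1 - 2^-1 ^+ m.+1 : R) ^+ (2 ^ m.+1))); last first.
  by rewrite ler_wiXn2l ?(ltnW km)// ?subr_ge0// gerBl ltW.
elim: m {k km} => [|m IH].
  rewrite !expn1 expr1 [in leRHS]expr2; lra.
apply: (le_trans IH); rewrite [in leRHS]expnS exprM.
apply: lerXn2r; rewrite ?nnegrE ?exprn_ge0 ?subr_ge0//.
rewrite [2^-1 ^+ m.+2]exprS; set x := 2^-1 ^+ m.+1.
by have := sqr_ge0 x; rewrite !expr2; lra.
Qed.

(** * Growth along the radii [1 - 2^-n] *)

Section RadialGrowth.
Variables (mu c F : nat -> R) (alpha K1 K2 : R) (k0 : nat).
Hypotheses (mu0 : forall n, 0 <= mu n) (mud : {homo mu : n k / (n <= k)%N >-> k <= n}).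
Hypotheses (K1_gt0 : 0 < K1) (K2_gt0 : 0 < K2).
Hypothesis cK : forall n,
  K1 * n.+1%:R `^ alpha <= c n <= K2 * n.+1%:R `^ alpha.
Hypothesis F_ge : forall n N,
  \sum_(0 <= k < N) c k * mu k * (1 - 2^-1 ^+ n) ^+ k <= F n.
Hypothesis F_le : forall n,
  F n <= 2 * \sum_(0 <= k < 2 ^ (n + k0)) c k * mu k.

(** [F n] plays the role of [f(1 - 2^-n)] and is known only through [F_ge] and [F_le]. From [F] to
    [mu], a single block of the series is enough, because [(1 - 2^-n)^k >= 1/4] there. From [mu] to
    [F], [F n] is at most twice the sum of the blocks [A 0], ..., [A (n + k0)], and Hardy's
    inequality, whose ratio [2 ^ (- g q)] is below 1 as [0 < g], reduces this sum to single
    blocks. *)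
Lemma radial_growth_psums (g q : R) : 0 < g -> 0 < q ->
  bounded_psums (fun n => (2 `^ (- g * q)) ^+ n * F n `^ q) <->
  bounded_psums (fun n => (2 `^ ((alpha + 1 - g) * q)) ^+ n * mu (2 ^ n)%N `^ q).
Proof.
move=> g0 q0.
have c0 n : 0 <= c n.
  have /andP[+ _] := cK n; apply: le_trans.
  by rewrite mulr_ge0 ?powR_ge0 ?ltW.
have r0 n : 0 <= 1 - 2^-1 ^+ n :> R.
  by rewrite subr_ge0 exprn_ile1 ?invr_ge0// invf_le1// ler1n.
have F0 n : 0 <= F n.
  by apply: le_trans (F_ge n 0); rewrite big_geq.
have E (K : R) m n : 0 <= K ->
    (K * ((2 `^ (alpha + 1)) ^+ m * mu n)) `^ q =
    K `^ q * ((2 `^ ((alpha + 1) * q)) ^+ m * mu n `^ q).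
  move=> K0; rewrite powRM ?mulr_ge0 ?exprn_ge0 ?powR_ge0//; congr (_ * _).
  by rewrite powRM ?exprn_ge0 ?powR_ge0// powR_exprAC ?powR_ge0// -!powRrM.
have Eg m : (2 `^ ((alpha + 1 - g) * q)) ^+ m =
    (2 `^ (- g * q)) ^+ m * (2 `^ ((alpha + 1) * q)) ^+ m.
  by rewrite -exprMn -powRD ?pnatr_eq0 ?implybT// -mulrDl [- g + _]addrC.
pose A n := \sum_(kellogg_lo n <= k < 2 ^ n) c k * mu k.
have A0 n : 0 <= A n by apply: sumr_ge0 => k _; rewrite mulr_ge0.
set l := 2 `^ (- g * q).
have l0 : 0 < l by rewrite powR_gt0.
have l1 : l < 1.
  rewrite /l mulNr -[ltRHS](powRr0 2) /powR gt_eqF// ltr_expR mul0r mulNr oppr_lt0.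
  by rewrite !mulr_gt0// ln_gt0// ltr1n.
split=> H.
  apply/bounded_psums_shift; move: ((bounded_psums_shift _).2 H).
  pose K := 4^-1 * (K1 * 2 `^ (- `|alpha|)).
  have K0 : 0 < K by rewrite !mulr_gt0 ?powR_gt0// invr_gt0.
  apply: (@le_bounded_psums _ _ _ (2 `^ ((alpha + 1) * q) * (K `^ q)^-1)).
    by rewrite mulr_ge0 ?invr_ge0 ?powR_ge0.
  move=> m; rewrite Eg -mulrA [in leLHS]exprS.
  have /(ler_wpM2l (exprn_ge0 m.+1 (ltW l0))) : K `^ q *
      ((2 `^ ((alpha + 1) * q)) ^+ m * mu (2 ^ m.+1)%N `^ q) <= F m.+1 `^ q.
    rewrite -E ?(ltW K0)//; apply: ge0_ler_powR; rewrite ?nnegrE ?(ltW q0) ?F0//.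
      by apply: mulr_ge0; [exact: ltW|rewrite mulr_ge0 ?exprn_ge0 ?powR_ge0].
    apply: le_trans (F_ge _ (2 ^ m.+1)).
    rewrite (@big_cat_nat _ _ _ (2 ^ m))//= ?leq_exp2l//.
    apply: ler_wpDl; first by apply: sumr_ge0 => k _; rewrite !mulr_ge0 ?exprn_ge0.
    apply: (@le_trans _ _ (4^-1 * A m.+1)).
      rewrite /K -mulrA ler_wpM2l ?invr_ge0//; apply: block_sum_ge => //.
        exact: ltW.
      by move=> n; case/andP : (cK n).
    rewrite /A mulr_sumr; apply: ler_sum_nat => k /andP[_ km].
    by rewrite mulrC ler_wpM2l ?mulr_ge0// dyadic_radius_exp.
  rewrite -/l => FK.
  have -> : 2 `^ ((alpha + 1) * q) / K `^ q * (l ^+ m.+1 * F m.+1 `^ q) =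
    (K `^ q)^-1 * (2 `^ ((alpha + 1) * q) * (l ^+ m.+1 * F m.+1 `^ q)) by ring.
  rewrite ler_pdivlMl ?powR_gt0//.
  have : 0 <= 2 `^ ((alpha + 1) * q) by exact: powR_ge0.
  move=> /ler_wpM2l/(_ _ _ FK); apply: le_trans.
  by rewrite le_eqVlt; apply/orP; left; apply/eqP; rewrite !exprS; ring.
have : bounded_psums (fun n => l ^+ n * A n `^ q).
  apply/bounded_psums_shift; move: H.
  pose K := K2 * 2 `^ `|alpha|.
  have K0 : 0 < K by rewrite !mulr_gt0 ?powR_gt0.
  apply: (@le_bounded_psums _ _ _ (l * K `^ q)).
    by rewrite mulr_ge0 ?powR_ge0 ?ltW.
  move=> m; rewrite Eg -/l exprS.
  have -> (x y : R) : l * K `^ q * (l ^+ m * x * y) =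
    l * l ^+ m * (K `^ q * (x * y)) by ring.
  rewrite ler_wpM2l ?mulr_ge0 ?exprn_ge0 ?(ltW l0)// -E ?(ltW K0)//.
  apply: ge0_ler_powR; rewrite ?nnegrE ?(ltW q0) ?A0//.
    by apply: mulr_ge0; [exact: ltW|rewrite mulr_ge0 ?exprn_ge0 ?powR_ge0].
  apply: block_sum_le => //; first exact: ltW.
  by move=> n; rewrite c0; case/andP : (cK n).
move=> /(discrete_hardy _ q0 A0); rewrite l0 l1 => /(_ isT).
(* The [k0] additional blocks cost only the constant factor [l ^ - k0]. *)
move=> /((bounded_psums_shiftn k0 _).2).
apply: (@le_bounded_psums _ _ _ (2 `^ q * (l ^+ k0)^-1)).
  by rewrite mulr_ge0 ?invr_ge0 ?powR_ge0 ?exprn_ge0 ?(ltW l0).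
move=> n; rewrite exprD.
have -> (x : R) : 2 `^ q / l ^+ k0 * (l ^+ n * l ^+ k0 * x) = l ^+ n * (2 `^ q * x).
  by field; rewrite gt_eqF// exprn_gt0.
have S0 : 0 <= \sum_(0 <= j < (n + k0).+1) A j by apply: sumr_ge0.
rewrite ler_wpM2l ?exprn_ge0 ?(ltW l0)// -powRM//.
apply: ge0_ler_powR; rewrite ?nnegrE ?(ltW q0) ?F0 ?mulr_ge0//.
by rewrite sum_kellogg_blocks.
Qed.

End RadialGrowth.
End DyadicBlocks.

(** * Binomial coefficients with real exponent *)

(** The lower bound is the upper bound for the reciprocal, as [1 / (1 + x) = 1 - x / (1 + x)]. *)
Lemma ln1D_bounds (R : realType) (x : R) : -1 < x ->
  x / (1 + x) <= ln (1 + x) <= x.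
Proof.
move=> x1; have x0 : 0 < 1 + x by lra.
rewrite le_ln1Dx// andbT -[X in ln X]invrK lnV ?posrE ?invr_gt0//.
have E : (1 + x)^-1 = 1 + (- (x / (1 + x))) by field; rewrite gt_eqF.
rewrite lerNr [in ln _]E; apply: le_ln1Dx.
by rewrite ltrN2 ltr_pdivrMr//; lra.
Qed.

(** For [m = n + 1], [1 + alpha / m] is the ratio [c_(n+1) / c_n] and [1 + 1 / m] is the ratio
    [(n + 2) / (n + 1)]. The discrepancy is of order [m^-2]; bounding it by [1/m - 1/(m+1)] makes
    its sum over [n] telescope. *)
Lemma binomial_log_ratio (R : realType) (alpha : R) : -1 < alpha ->
  exists2 K, 0 <= K & forall m : R, 1 <= m ->
    `|ln (1 + alpha / m) - alpha * ln (1 + m^-1)| <= K * (m^-1 - (m + 1)^-1).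
Proof.
move=> a1; have a0 : 0 < 1 + alpha by lra.
(* The summands serve, in order, the upper bound for [alpha >= 0], the lower bound for [alpha >= 0]
   and the lower bound for [alpha < 0]; in the remaining case the difference is nonpositive. *)
pose K := `|alpha| + 2 * alpha ^+ 2 + `|alpha| * (`|alpha| + 1) / (1 + alpha).
have K3 : 0 <= `|alpha| * (`|alpha| + 1) / (1 + alpha).
  by apply: divr_ge0; [rewrite mulr_ge0 ?addr_ge0|exact: ltW].
have K2 : 0 <= 2 * alpha ^+ 2 by rewrite mulr_ge0 ?sqr_ge0.
exists K; first by rewrite /K addr_ge0// addr_ge0.
move=> m m1.
have m0 : 0 < m by lra.
have ma : 0 < m + alpha by lra.
have m1m : 0 < m * (m + 1) by rewrite mulr_gt0//; lra.
have -> : m^-1 - (m + 1)^-1 = (m * (m + 1))^-1.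
  by field; apply/andP; split; rewrite gt_eqF//; lra.
have /andP[L1 L2] : alpha / (m + alpha) <= ln (1 + alpha / m) <= alpha / m.
  have -> : alpha / (m + alpha) = (alpha / m) / (1 + alpha / m).
    by field; rewrite !gt_eqF.
  by apply: ln1D_bounds; rewrite ltr_pdivlMr//; nra.
have /andP[l1 l2] : (m + 1)^-1 <= ln (1 + m^-1) <= m^-1.
  have -> : (m + 1)^-1 = m^-1 / (1 + m^-1).
    by field; rewrite !gt_eqF//; lra.
  by apply: ln1D_bounds; apply: (@lt_trans _ _ 0); rewrite ?invr_gt0//; lra.
have K1 : `|alpha| <= K by rewrite /K -addrA lerDl addr_ge0.
have hinv : 0 <= (m * (m + 1))^-1 by rewrite invr_ge0 ltW.
have [ap|an] := leP 0 alpha.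
  rewrite ler_norml; apply/andP; split.
    rewrite lerNl opprB.
    apply: (@le_trans _ _ (alpha / m - alpha / (m + alpha))).
      by rewrite lerB// ler_wpM2l.
    have -> : alpha / m - alpha / (m + alpha) = alpha ^+ 2 / (m * (m + alpha)).
      by field; rewrite !gt_eqF.
    apply: (@le_trans _ _ (2 * alpha ^+ 2 / (m * (m + 1)))).
      have -> : 2 * alpha ^+ 2 / (m * (m + 1)) =
        alpha ^+ 2 * (2 / (m * (m + 1))) by ring.
      rewrite ler_wpM2l ?sqr_ge0//.
      rewrite -[2]invrK -invfM lef_pV2 ?posrE ?mulr_gt0 ?invr_gt0//; last by lra.
      by nra.
    by rewrite ler_wpM2r// /K addrAC lerDr addr_ge0.
  apply: (@le_trans _ _ (`|alpha| / (m * (m + 1)))); last by rewrite ler_wpM2r.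
  apply: (@le_trans _ _ (alpha / m - alpha / (m + 1))).
    by rewrite lerB// ler_wpM2l.
  rewrite ger0_norm// le_eqVlt; apply/orP; left; apply/eqP; field.
  by rewrite !gt_eqF//; lra.
rewrite ler_norml; apply/andP; split.
  rewrite lerNl opprB.
  apply: (@le_trans _ _ (alpha / (m + 1) - alpha / (m + alpha))).
    by rewrite lerB// ler_wnM2l// ltW.
  have -> : alpha / (m + 1) - alpha / (m + alpha) =
    `|alpha| * (`|alpha| + 1) / ((m + alpha) * (m + 1)).
    by rewrite ltr0_norm//; field; rewrite !gt_eqF//; lra.
  apply: (@le_trans _ _ (`|alpha| * (`|alpha| + 1) / (1 + alpha) / (m * (m + 1)))).
    rewrite -[leRHS]mulrA -invfM ler_wpM2l ?mulr_ge0 ?addr_ge0//.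
    rewrite lef_pV2 ?posrE ?mulr_gt0//; try by lra.
    by rewrite mulrA ler_pM2r; [nra|lra].
  by rewrite ler_wpM2r// /K lerDr addr_ge0.
apply: (@le_trans _ _ 0); last by rewrite mulr_ge0// addr_ge0// addr_ge0.
rewrite subr_le0; apply: (le_trans L2).
by rewrite ler_wnM2l// ltW.
Qed.

(** * Elementary bounds for sine and cosine *)

Lemma sin_MVT (R : realType) (u : R) : 0 < u ->
  exists2 x, 0 < x < u & sin u = cos x * u.
Proof.
move=> u0; have [|x] := @MVT R sin cos 0 u u0 (fun x _ => is_derive_sin x).
  by apply: continuous_subspaceT => x; exact: continuous_sin.
by rewrite in_itv/= sin0 !subr0 => xu; exists x.
Qed.

Lemma normr_sin_le (R : realType) (u : R) : `|sin u| <= `|u|.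
Proof.
have H (x : R) : 0 <= x -> `|sin x| <= x.
  rewrite le_eqVlt => /predU1P[<-|x0]; first by rewrite sin0 normr0.
  have [y _ ->] := sin_MVT x0.
  by rewrite normrM (gtr0_norm x0) ler_piMl ?cos_max// ltW.
have [u0|u0] := leP 0 u; first by rewrite [leRHS]ger0_norm// H.
by rewrite -normrN -sinN [leRHS]ltr0_norm// H// oppr_ge0 ltW.
Qed.

Lemma cos_half_angle (R : realType) (t : R) : cos t = 1 - 2 * sin (t / 2) ^+ 2.
Proof.
have {1}-> : t = (t / 2) *+ 2 by rewrite -mulr_natr mulfVK.
by rewrite cos_mulr2n cos2sin2 mulr2n; ring.
Qed.

Lemma cos_ge_quadratic (R : realType) (t : R) : 1 - t ^+ 2 / 2 <= cos t.
Proof.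
rewrite cos_half_angle lerD2l lerN2.
have : sin (t / 2) ^+ 2 <= (t / 2) ^+ 2.
  rewrite -(real_normK (num_real (sin _))) -(real_normK (num_real (t / 2))).
  by rewrite lerXn2r ?nnegrE// normr_sin_le.
by rewrite !expr2; lra.
Qed.

(** On [[0, 1]] the mean value theorem and [cos >= 1/2] give slope [1/2]; the duplication formula
    extends the bound to [[0, 2]], an interval that contains every half-angle up to [pi / 2]. *)
Lemma sin_ge_linear (R : realType) (u : R) : 0 <= u <= 2 -> u / 4 <= sin u.
Proof.
have H (x : R) : 0 <= x <= 1 -> x / 2 <= sin x.
  move=> /andP[]; rewrite le_eqVlt => /predU1P[<- _|x0 x1].
    by rewrite sin0 mul0r.
  have [y /andP[y0 yx] ->] := sin_MVT x0.
  by rewrite mulrC ler_wpM2r// ?(ltW x0)//; have := cos_ge_quadratic y; nra.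
move=> /andP[u0 u2].
have -> : sin u = 2 * (cos (u / 2) * sin (u / 2)).
  have E : u = (u / 2) *+ 2 by rewrite -mulr_natr mulfVK.
  by rewrite mulr_natl -sin_mulr2n -E.
have h : 0 <= u / 2 <= 1 by lra.
have h1 := H _ h.
have h2 : 2^-1 <= cos (u / 2).
  by apply: le_trans (cos_ge_quadratic _); rewrite expr2; nra.
have h3 : 0 <= u / 2 / 2 by lra.
have h4 : 0 <= 2^-1 :> R by rewrite invr_ge0.
by have := ler_pM h4 h3 h2 h1; lra.
Qed.

(** * Coefficients given by the recursion of [(1 - z)^-(1 + alpha)] *)

Section BinomialCoefficients.
Context {R : realType}.
Variables (alpha : R) (c mu : nat -> R).
Hypotheses (alpha_gt : -1 < alpha) (c0 : c 0%N = 1).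
Hypothesis cS : forall n, n.+1%:R * c n.+1 = (n%:R + alpha + 1) * c n.

Lemma binomial_coef_gt0 n : 0 < c n.
Proof.
elim: n => [|n IH]; first by rewrite c0.
rewrite -(pmulr_rgt0 _ (ltr0Sn R n)) cS mulr_gt0//.
have a := alpha_gt; have n0 : 0 <= n%:R :> R by []. lra.
Qed.

Lemma binomial_coef_growth : exists K1 K2 : R, [/\ 0 < K1, 0 < K2 &
  forall n, K1 * n.+1%:R `^ alpha <= c n <= K2 * n.+1%:R `^ alpha].
Proof.
have a1 := alpha_gt; have [K K0 HK] := binomial_log_ratio alpha_gt.
(* The induction carries the telescoped bound [K (1 - 1/(n+1))]; the bound [K] alone would not be
   inductive. *)
have H n : `|ln (c n) - alpha * ln n.+1%:R| <= K * (1 - n.+1%:R^-1).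
  elim: n => [|n IH]; first by rewrite c0 ln1 mulr0 subr0 normr0 invr1 subrr mulr0.
  move: IH; set m : R := n.+1%:R => IH.
  have m1 : 1 <= m by rewrite ler1n.
  have HKn := HK m m1.
  have m0 : 0 < m by lra.
  have mS : n.+2%:R = m + 1 :> R by rewrite natr1.
  have cSn : c n.+1 = c n * (1 + alpha / m).
    apply: (mulfI (lt0r_neq0 m0)); rewrite cS.
    have -> : n%:R = m - 1 :> R by rewrite /m -natr1 addrK.
    by field; rewrite gt_eqF.
  have p1 : 0 < 1 + alpha / m.
    by rewrite -[1](mulfV (lt0r_neq0 m0)) -mulrDl divr_gt0//; lra.
  have p2 : 0 < 1 + m^-1 by rewrite addr_gt0// invr_gt0.
  have -> : ln (c n.+1) - alpha * ln n.+2%:R =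
     (ln (c n) - alpha * ln m) + (ln (1 + alpha / m) - alpha * ln (1 + m^-1)).
    rewrite cSn lnM ?posrE ?binomial_coef_gt0// mS.
    have -> : m + 1 = m * (1 + m^-1) by field; rewrite gt_eqF.
    by rewrite [in LHS]lnM ?posrE//; ring.
  apply: (le_trans (ler_normD _ _)); apply: (le_trans (lerD IH HKn)).
  by rewrite -mulrDr; apply: ler_wpM2l => //; rewrite mS addrA subrK lexx.

exists (expR (- K)); exists (expR K); split; [exact: expR_gt0|exact: expR_gt0|move=> n].
have {H} : `|ln (c n) - alpha * ln n.+1%:R| <= K.
  by apply: (le_trans (H n)); rewrite ler_piMr// gerBl invr_ge0.
rewrite ler_norml /powR pnatr_eq0/= -!expRD -{3 4}(lnK (_ : c n \in Num.pos)); last first.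
  by rewrite posrE binomial_coef_gt0.
by rewrite !ler_expR => /andP[h1 h2]; apply/andP; split; lra.
Qed.

Hypotheses (mu0 : forall n, 0 <= mu n).
Hypothesis mud : {homo mu : n k / (n <= k)%N >-> k <= n}.

Let a n := c n * mu n.

Let a_ge0 n : 0 <= a n. Proof. by rewrite mulr_ge0// ltW// binomial_coef_gt0. Qed.

Let aS_le n : n.+1%:R * a n.+1 <= (n%:R + (1 + alpha)) * a n.
Proof.
rewrite /a !mulrA cS -addrA [alpha + 1]addrC ler_wpM2l ?mud//.
rewrite mulr_ge0// ?(ltW (binomial_coef_gt0 _))//.
by have := alpha_gt; have := ler0n R n; lra.
Qed.

Let t_ge0 n (x : R) : 0 <= x -> 0 <= a n * x ^+ n.
Proof. by move=> x0; rewrite mulr_ge0 ?exprn_ge0. Qed.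

(* Since n c_n = (n + alpha) c_(n-1) and mu decreases, the sum S1 of n a_n x^n and
   the sum S0 of a_n x^n satisfy S1 <= x (S1 + (1 + alpha) S0), already at the level
   of partial sums. *)
Lemma first_moment_le (x : R) N : 0 <= x <= 1 ->
  (1 - x) * (\sum_(0 <= n < N) n%:R * (a n * x ^+ n)) <=
  (1 + alpha) * (\sum_(0 <= n < N) a n * x ^+ n).
Proof.
have a1 := alpha_gt; move=> /andP[x0 x1].
have step : \sum_(0 <= n < N) n%:R * (a n * x ^+ n) <= x *
   (\sum_(0 <= n < N) n%:R * (a n * x ^+ n) +
    (1 + alpha) * (\sum_(0 <= n < N) a n * x ^+ n)).
  case: N => [|N]; first by rewrite !big_geq// !(mulr0, addr0).
  rewrite [leLHS]big_nat_recl//= mul0r add0r.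
  rewrite mulr_sumr -big_split/= mulr_sumr big_nat_recr//=.
  apply: ler_wpDr.
    have N0 : 0 <= N%:R :> R by [].
    rewrite mulr_ge0// -mulrDl; apply: mulr_ge0; [lra|exact: t_ge0].
  apply: ler_sum_nat => n _.
  have -> : n.+1%:R * (a n.+1 * x ^+ n.+1) =
      (x * x ^+ n) * (n.+1%:R * a n.+1) by rewrite exprS; ring.
  apply: (le_trans (ler_wpM2l _ (aS_le n))); first by rewrite mulr_ge0 ?exprn_ge0.
  by rewrite le_eqVlt; apply/orP; left; apply/eqP; ring.
have S0 : 0 <= \sum_(0 <= n < N) a n * x ^+ n.
  by apply: sumr_ge0 => n _; rewrite mulr_ge0 ?exprn_ge0.
rewrite mulrBl mul1r lerBlDl; apply: (le_trans step).
rewrite mulrDr lerD2l ler_piMl// mulr_ge0//; lra.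
Qed.

(** The recursion of the first moment, one order higher: [(n + 1)(n + 1 + alpha) = n^2 + (2 + alpha)
    n + (1 + alpha)] gives [S2 <= x (S2 + (2 + alpha) S1 + (1 + alpha) S0)]. With the bound on
    [(1 - x) S1], the constant is [(2 + alpha)(1 + alpha) + (1 + alpha)]. *)
Lemma second_moment_le (x : R) N : 0 <= x <= 1 ->
  (1 - x) ^+ 2 * (\sum_(0 <= n < N) n%:R ^+ 2 * (a n * x ^+ n)) <=
  (3 + alpha) * (1 + alpha) * (\sum_(0 <= n < N) a n * x ^+ n).
Proof.
have a1 := alpha_gt; move=> /[dup] x01 /andP[x0 x1].
have := first_moment_le N x01.
set S0 := \sum_(0 <= n < N) a n * x ^+ n.
set S1 := \sum_(0 <= n < N) n%:R * (a n * x ^+ n).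
set S2 := \sum_(0 <= n < N) n%:R ^+ 2 * (a n * x ^+ n) => H1.
have S0_ge0 : 0 <= S0.
  by apply: sumr_ge0 => n _; exact: t_ge0.
have S1_ge0 : 0 <= S1.
  by apply: sumr_ge0 => n _; rewrite mulr_ge0 ?t_ge0.
have step : S2 <= x * (S2 + (2 + alpha) * S1 + (1 + alpha) * S0).
  rewrite {S0_ge0 S1_ge0 H1} /S0 /S1 /S2.
  case: (N) => [|N1]; first by rewrite !big_geq// !(mulr0, addr0).
  rewrite [leLHS]big_nat_recl//= expr0n/= mul0r add0r.
  rewrite !mulr_sumr -!big_split/= mulr_sumr big_nat_recr//=.
  apply: ler_wpDr.
    have t0 := t_ge0 N1 x0.
    apply: mulr_ge0 => //; apply: addr_ge0; last by apply: mulr_ge0 => //; lra.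
    apply: addr_ge0; apply: mulr_ge0; rewrite ?sqr_ge0//; first by lra.
    exact: mulr_ge0.
  apply: ler_sum_nat => n _.
  have -> : n.+1%:R ^+ 2 * (a n.+1 * x ^+ n.+1) =
      (x * (x ^+ n * n.+1%:R)) * (n.+1%:R * a n.+1) by rewrite [x ^+ n.+1]exprS; ring.
  apply: (le_trans (ler_wpM2l _ (aS_le n))).
    by rewrite !mulr_ge0 ?exprn_ge0.
  by rewrite -natr1 le_eqVlt; apply/orP; left; apply/eqP; ring.
have H2 : (1 - x) * S2 <= (2 + alpha) * S1 + (1 + alpha) * S0.
  rewrite mulrBl mul1r lerBlDl; apply: (le_trans step).
  rewrite -addrA mulrDr lerD2l ler_piMl// addr_ge0// mulr_ge0//; lra.
have y0 : 0 <= 1 - x by lra.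
rewrite expr2 -mulrA; apply: (le_trans (ler_wpM2l y0 H2)).
have : (1 - x) * ((1 + alpha) * S0) <= (1 + alpha) * S0.
  by rewrite ler_piMl ?mulr_ge0//; lra.
have : (2 + alpha) * ((1 - x) * S1) <= (2 + alpha) * ((1 + alpha) * S0).
  by rewrite ler_wpM2l//; lra.
lra.
Qed.

(* Markov's inequality for the weights a_n x^n; it also yields the convergence of
   the series for x < 1. *)
Lemma truncation_le (x : R) N M : 0 <= x <= 1 ->
  2 * (1 + alpha) <= N%:R * (1 - x) ->
  \sum_(0 <= n < M) a n * x ^+ n <= 2 * \sum_(0 <= n < N) a n * x ^+ n.
Proof.
have a1 := alpha_gt; move=> /[dup] x01 /andP[x0 x1] HN.
have t0 n : 0 <= a n * x ^+ n by exact: t_ge0.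
have [MN|NM] := leqP M N.
  rewrite mulr_natl mulr2n; apply: ler_wpDr; first exact: sumr_ge0.
  by rewrite [leRHS](big_cat_nat (leq0n M) MN)//= lerDl sumr_ge0.
have := first_moment_le M x01.
rewrite !(big_cat_nat (leq0n N) (ltnW NM))//=.
set P := \sum_(0 <= n < N) a n * x ^+ n.
set T := \sum_(N <= n < M) a n * x ^+ n.
set P1 := \sum_(0 <= n < N) n%:R * (a n * x ^+ n).
set T1 := \sum_(N <= n < M) n%:R * (a n * x ^+ n) => H1.
have P0 : 0 <= P by exact: sumr_ge0.
have T0 : 0 <= T by exact: sumr_ge0.
have P10 : 0 <= P1 by apply: sumr_ge0 => n _; rewrite mulr_ge0.
have T1N : N%:R * T <= T1.
  rewrite mulr_sumr; apply: ler_sum_nat => n /andP[Nn _].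
  by rewrite ler_wpM2r// ler_nat.
have a0 : 0 < 1 + alpha by lra.
(* The choice of [N] turns the first moment bound into [2 T <= P + T], that is, [T <= P]. *)
suff : (1 + alpha) * (2 * T) <= (1 + alpha) * (P + T) by rewrite ler_pM2l//; lra.
apply: le_trans H1; have y0 : 0 <= 1 - x by lra.
have := ler_wpM2l y0 T1N; have := ler_wpM2r T0 HN; have := mulr_ge0 y0 P10.
lra.
Qed.

(** The condition on [t] is what the second moment bound needs to give [t^2 S2 <= S0]; the quadratic
    loss in the cosines then removes at most half of the sum. *)
Lemma cos_psum_ge (x t : R) N : 0 <= x < 1 ->
  t ^+ 2 * ((3 + alpha) * (1 + alpha)) <= (1 - x) ^+ 2 ->
  2^-1 * (\sum_(0 <= n < N) a n * x ^+ n) <=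
  \sum_(0 <= n < N) a n * x ^+ n * cos (n%:R * t).
Proof.
move=> /andP[x0 x1] Ht.
have x01 : 0 <= x <= 1 by rewrite x0 ltW.
have := second_moment_le N x01.
set S0 := \sum_(0 <= n < N) a n * x ^+ n.
set S2 := \sum_(0 <= n < N) n%:R ^+ 2 * (a n * x ^+ n) => H2.
have S0_ge0 : 0 <= S0.
  by apply: sumr_ge0 => n _; exact: t_ge0.
apply: (@le_trans _ _ (S0 - t ^+ 2 / 2 * S2)); last first.
  rewrite /S0 /S2 mulr_sumr -sumrB; apply: ler_sum_nat => n _.
  apply: (@le_trans _ _ (a n * x ^+ n * (1 - (n%:R * t) ^+ 2 / 2))).
    by rewrite le_eqVlt exprMn; apply/orP; left; apply/eqP; ring.
  by apply: ler_wpM2l; rewrite ?t_ge0 ?cos_ge_quadratic.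
suff : t ^+ 2 * S2 <= S0 by lra.
have y0 : 0 < (1 - x) ^+ 2 by rewrite exprn_gt0// subr_gt0.
rewrite -(ler_pM2l y0) mulrCA; apply: (le_trans (ler_wpM2l (sqr_ge0 t) H2)).
by rewrite mulrA ler_wpM2r.
Qed.

End BinomialCoefficients.

(** * The Gamma function *)

(* Unlike [ge0_le_integral], no measurability is required. *)
Lemma ge0_integral_le d (T : measurableType d) (R : realType)
    (mu : {measure set T -> \bar R}) (D : set T) (f g : T -> \bar R) :
  (forall x, D x -> 0 <= f x)%E -> (forall x, D x -> f x <= g x)%E ->
  (\int[mu]_(x in D) f x <= \int[mu]_(x in D) g x)%E.
Proof.
move=> f0 fg; rewrite integral_mkcond [leRHS]integral_mkcond.
have H x : (0 <= (f \_ D) x <= (g \_ D) x)%E.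
  rewrite !patchE; case: ifPn => [|_]; last by rewrite lexx.
  by rewrite inE => Dx; rewrite f0// fg.
rewrite !ge0_integralTE//; last 2 first.
- by move=> x; have /andP[h1 h2] := H x; exact: le_trans h2.
- by move=> x; case/andP: (H x).
apply: le_ereal_sup => _ [h hf <-]; exists h => // x.
by apply: (le_trans (hf x)); case/andP: (H x).
Qed.

Section GammaFunction.
Context {R : realType}.
Implicit Types (s t : R).

Definition gamma_integrand (s t : R) : R := t `^ (s - 1) * expR (- t).

(** Kept in the extended reals, so that the functional equation can be proved before convergence is
    known; convergence for small [s] is deduced from it. *)
Definition gamma_integral (s : R) : \bar R :=
  (\int[lebesgue_measure]_(t in `]0%R, +oo[) (gamma_integrand s t)%:E)%E.

Lemma gamma_integrand_ge0 s t : 0 <= gamma_integrand s t.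
Proof. by rewrite mulr_ge0 ?powR_ge0 ?expR_ge0. Qed.

Lemma GammaE s : Gamma s = fine (gamma_integral s).
Proof. by []. Qed.

Lemma continuous_powR_gt0 s t : 0 < t -> {for t, continuous (@powR R ^~ s)}.
Proof.
move=> t0; apply/differentiable_continuous; rewrite -derivable1_diffP.
by apply: derivable_powR; rewrite in_itv/= andbT.
Qed.

Lemma measurable_gamma_integrand s (D : set R) : measurable D ->
  measurable_fun D (gamma_integrand s).
Proof.
move=> mD; apply: measurable_funM => //.
  by apply: measurable_funTS; exact: measurable_powR.
apply: measurable_funTS; apply: measurableT_comp => //.
Qed.

(* An exhaustion of ]0, +oo[ for which the boundary terms of the integration by
   parts decay geometrically. *)
Let E n : set R := `[expR (- n.+1%:R), expR n.+1%:R]%classic.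

Let E_gt0 n t : E n t -> 0 < t.
Proof. by rewrite /E/= in_itv/= => /andP[+ _]; apply: lt_le_trans; exact: expR_gt0. Qed.

Let bigcup_E : \bigcup_n E n = `]0, +oo[%classic.
Proof.
apply/seteqP; split=> [t [n _ /E_gt0 t0]|t /=]; rewrite /= in_itv/= andbT// => t0.
exists (Num.truncn `|ln t|) => //; rewrite /E/= in_itv/= -[X in _ <= X <= _]lnK//.
rewrite !ler_expR -ler_norml; apply/ltW.
exact: truncnS_gt.
Qed.

Let gamma_integral_cvg s :
  (\int[lebesgue_measure]_(t in E n) (gamma_integrand s t)%:E)%E @[n --> \oo] -->
  gamma_integral s.
Proof.
rewrite /gamma_integral -bigcup_E.
apply: ge0_nondecreasing_set_cvg_integral => //.
- apply/nondecreasing_seqP => n; apply/subsetPset => t.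
  rewrite /E/= !in_itv/= => /andP[h1 h2]; apply/andP; split.
    by apply: le_trans h1; rewrite ler_expR lerN2 ler_nat.
  by apply: (le_trans h2); rewrite ler_expR ler_nat.
- by move=> n; exact: measurable_itv.
- move=> n; apply: measurableT_comp => //.
  by apply: measurable_gamma_integrand; exact: measurable_itv.
- by move=> n t _; rewrite lee_fin gamma_integrand_ge0.
Qed.

(** This is [ln x <= x] at [x = t / (2 s)], which gives [s ln t <= t / 2 + s ln (2 s)]. *)
Lemma powR_expRN_le s t : 0 < s -> 0 < t ->
  t `^ s * expR (- t) <= (2 * s) `^ s * expR (- (t / 2)).
Proof.
move=> s0 t0; rewrite /powR !gt_eqF ?mulr_gt0// -!expRD ler_expR.
have -> : ln t = ln (t / (2 * s)) + ln (2 * s).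
  by rewrite -lnM ?posrE ?divr_gt0 ?mulr_gt0// mulfVK// gt_eqF// mulr_gt0.
have : s * ln (t / (2 * s)) <= t / 2.
  rewrite -ler_pdivlMl// ltW//; have -> : s^-1 * (t / 2) = t / (2 * s).
    by field; rewrite gt_eqF.
  by apply: ln_sublinear; rewrite divr_gt0// mulr_gt0.
by rewrite mulrDr; lra.
Qed.

Let boundary s n : R :=
  expR (- n.+1%:R) `^ s * expR (- expR (- n.+1%:R)) -
  expR n.+1%:R `^ s * expR (- expR n.+1%:R).

Let boundary_cvg s : 0 < s -> boundary s n @[n --> \oo] --> 0.
Proof.
move=> s0; rewrite -[X in _ --> X](subr0 0); apply: cvgB.
  apply: (@squeeze_cvgr _ _ _ _ (cst 0) (fun n => (expR (- s)) ^+ n.+1)).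
  - near=> n; rewrite mulr_ge0 ?powR_ge0 ?expR_ge0//=.
    rewrite -expRM -expRM_natl -expRD ler_expR mulNr mulrN gerDl oppr_le0.
    exact: expR_ge0.
  - exact: cvg_cst.
  - rewrite (cvg_shiftS (fun n => expR (- s) ^+ n)).
    by apply: cvg_expr; rewrite ger0_norm ?expR_ge0// expR_lt1 oppr_lt0.
apply: (@squeeze_cvgr _ _ _ _ (cst 0)
    (fun n => (2 * s) `^ s * (expR (- 2^-1)) ^+ n.+1)).
- near=> n; rewrite mulr_ge0 ?powR_ge0 ?expR_ge0//=.
  apply: (le_trans (powR_expRN_le s0 (expR_gt0 _))).
  rewrite ler_wpM2l ?powR_ge0// -expRM_natl ler_expR.
  by have := expR_ge1Dx (n.+1%:R : R); move: (n.+1%:R) => x; lra.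
- exact: cvg_cst.
- rewrite -[X in _ --> X](mulr0 ((2 * s) `^ s)); apply: cvgMl_tmp.
  rewrite (cvg_shiftS (fun n => expR (- 2^-1) ^+ n)).
  by apply: cvg_expr; rewrite ger0_norm ?expR_ge0// expR_lt1 oppr_lt0.
Unshelve. all: by end_near. Qed.

Let integral_E s n : 0 < s ->
  (\int[lebesgue_measure]_(t in E n) (gamma_integrand (s + 1) t)%:E =
   (boundary s n)%:E +
   s%:E * \int[lebesgue_measure]_(t in E n) (gamma_integrand s t)%:E)%E.
Proof.
move=> s0.
have ab : expR (- n.+1%:R) < expR n.+1%:R :> R by rewrite ltr_expR gtrN.
have a0 : 0 < expR (- n.+1%:R) :> R by exact: expR_gt0.
have c1 t : {for t, continuous (fun x : R => expR (- x))}.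
  by apply: continuous_comp; [exact: opp_continuous|exact: continuous_expR].
have mE : measurable (E n) by exact: measurable_itv.
have toitv t : t \in `]expR (- n.+1%:R), expR n.+1%:R[ -> 0 < t.
  by rewrite in_itv/= => /andP[+ _]; apply: lt_trans.
have cF t : 0 < t -> {for t, continuous (fun t : R => s * t `^ (s - 1))}.
  by move=> t0; apply: continuousM; [exact: cvg_cst|exact: continuous_powR_gt0].
have H := @integration_by_parts R (@powR R ^~ s) (fun t => - expR (- t))
  (fun t => s * t `^ (s - 1)) (fun t => expR (- t)) _ _ ab.
under eq_integral do rewrite /gamma_integrand addrK.
rewrite {}H; last 1 first.
- move=> t _; rewrite derive1N// derive1_comp// derive1N// derive1_id mulrN1 derive1E.
  by have /funeqP -> := @derive_expR R; rewrite opprK.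
- have -> : (\int[lebesgue_measure]_(t in E n)
      (s * t `^ (s - 1) * - expR (- t))%:E =
    - (s%:E * \int[lebesgue_measure]_(t in E n) (gamma_integrand s t)%:E))%E.
    under eq_integral do rewrite mulrN EFinN.
    rewrite integral_ge0N; last first.
      by move=> t _; rewrite lee_fin !mulr_ge0 ?powR_ge0 ?expR_ge0// ltW.
    under eq_integral do rewrite -mulrA EFinM.
    rewrite ge0_integralZl//= ?lee_fin ?(ltW s0)//.
      by apply: measurableT_comp => //; apply: measurable_gamma_integrand.
    by move=> t _; rewrite lee_fin gamma_integrand_ge0.
  by rewrite oppeK /boundary; congr (_%:E + _)%E; ring.
- apply/continuous_within_itvP => //; split.
  + by move=> t /toitv; exact: cF.
  + by apply: cvg_at_right_filter; apply: cF; exact: expR_gt0.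
  + by apply: cvg_at_left_filter; apply: cF; exact: expR_gt0.
- split.
  + by move=> t /toitv t0; apply: derivable_powR; rewrite in_itv/= andbT.
  + by apply: cvg_at_right_filter; apply: continuous_powR_gt0; exact: expR_gt0.
  + by apply: cvg_at_left_filter; apply: continuous_powR_gt0; exact: expR_gt0.
- by move=> t /toitv t0; rewrite powR_derive1// in_itv/= andbT.
- by apply: continuous_subspaceT => t; exact: c1.
- split.
  + by move=> t _; exact: ex_derive.
  + by apply: cvg_at_right_filter; apply: cvgN; exact: c1.
  + by apply: cvg_at_left_filter; apply: cvgN; exact: c1.
Qed.

Lemma gamma_integralS s : 0 < s ->
  gamma_integral (s + 1) = (s%:E * gamma_integral s)%E.
Proof.
move=> s0; rewrite -[RHS]add0e -(cvg_lim (@ereal_hausdorff R) (@gamma_integral_cvg (s + 1))).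
apply: cvg_lim; first exact: ereal_hausdorff.
under eq_fun do rewrite integral_E//.
apply: cvgeD => //.
- apply: cvg_EFin; first by near=> n.
  exact: boundary_cvg.
- by apply: cvgeZl => //; exact: gamma_integral_cvg.
Unshelve. all: by end_near. Qed.

(** The integrand [t^s e^-t] is at most [2 (2 s)^s] times the exponential density of rate [1/2],
    whose total mass is 1. *)
Lemma gamma_integralS_lty s : 0 < s -> (gamma_integral (s + 1) < +oo)%E.
Proof.
move=> s0; pose C := (2 * s) `^ s * 2.
have C0 : 0 <= C by rewrite mulr_ge0 ?powR_ge0.
have half0 : 0 <= 2^-1 :> R by rewrite invr_ge0.
rewrite /gamma_integral integral_mkcond.
apply: (@le_lt_trans _ _ (\int[lebesgue_measure]_x
    (C%:E * (exponential_pdf (2^-1 : R) x)%:E))%E).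
  apply: ge0_integral_le => x _.
    by apply: erestrict_ge0 => y _; rewrite lee_fin gamma_integrand_ge0.
  rewrite patchE; case: ifPn => [|_]; last first.
    by rewrite mule_ge0 ?lee_fin// exponential_pdf_ge0.
  rewrite inE/= in_itv/= andbT => x0.
  rewrite exponential_pdfE ?(ltW x0)// -EFinM lee_fin /gamma_integrand addrK.
  apply: (le_trans (powR_expRN_le s0 x0)).
  rewrite /C -!mulrA ler_wpM2l ?powR_ge0// mulVKf//.
  by rewrite mulrC mulNr.
rewrite ge0_integralZl//=.
- by rewrite integral_exponential_pdf ?invr_gt0// mule1 ltry.
- by apply/measurable_EFinP; exact: measurable_exponential_pdf.
- by move=> x _; rewrite lee_fin exponential_pdf_ge0.
Qed.

(** For [s < 1] the integrand is singular at 0. Finiteness is read backwards from the functional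
    equation: an infinite integral at [s] would be infinite at [s + 1]. *)
Lemma gamma_integral_lty s : 0 < s -> (gamma_integral s < +oo)%E.
Proof.
move=> s0; rewrite ltey; apply/eqP => Iy.
by have := gamma_integralS_lty s0; rewrite gamma_integralS// Iy gt0_muley ?lte_fin// ltxx.
Qed.

Lemma gamma_integral_gt0 s : (0 < gamma_integral s)%E.
Proof.
pose c := 2 `^ (- `|s - 1|) * expR (- 2 : R).
have c0 : 0 < c by rewrite mulr_gt0 ?powR_gt0 ?expR_gt0.
apply: (@lt_le_trans _ _ (\int[lebesgue_measure]_(x in `[1%R, 2%R]) (cst c%:E x))%E).
  rewrite integral_cst//= lebesgue_measure_itv/= lte_fin ltr1n/=.
  by rewrite -EFinB -EFinM lte_fin mulr_gt0//; lra.
rewrite /gamma_integral integral_mkcond [leRHS]integral_mkcond.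
apply: ge0_integral_le => x _.
  by apply: erestrict_ge0 => y _; rewrite lee_fin ltW.
rewrite !patchE; case: ifPn => [|_]; last first.
  by case: ifPn => // _; rewrite lee_fin gamma_integrand_ge0.
rewrite inE/= in_itv/= => /andP[x1 x2].
rewrite ifT; last by rewrite inE/= in_itv/= andbT; lra.
rewrite lee_fin /c /gamma_integrand ler_pM ?powR_ge0 ?expR_ge0//.
  by have /(powR_half_two (s - 1))/andP[] : 2^-1 <= x <= 2 by lra.
by rewrite ler_expR lerN2.
Qed.

Lemma GammaS s : 0 < s -> Gamma (s + 1) = s * Gamma s.
Proof.
move=> s0; rewrite !GammaE gamma_integralS// fineM//.
by rewrite ge0_fin_numE ?gamma_integral_lty// ltW// gamma_integral_gt0.
Qed.

Lemma Gamma_gt0 s : 0 < s -> 0 < Gamma s.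
Proof.
by move=> s0; rewrite GammaE fine_gt0// gamma_integral_gt0 gamma_integral_lty.
Qed.

End GammaFunction.

(** * Complex power series *)

Section ComplexModulus.
Context {R : realType}.
Implicit Types (z w : R[i]) (x y : R).

Lemma normr_cabs z : `|z| = (cabs z)%:C. Proof. by []. Qed.

Lemma cabs_ge0 z : 0 <= cabs z.
Proof. by case: z => x y; exact: sqrtr_ge0. Qed.

Lemma cabsM z w : cabs (z * w) = cabs z * cabs w.
Proof. exact: ComplexField.Normc.normcM. Qed.

Lemma cabsX z n : cabs (z ^+ n) = cabs z ^+ n.
Proof.
by apply: complexI; rewrite -normr_cabs normrX normr_cabs rmorphXn.
Qed.

Lemma cabs_real x : cabs x%:C = `|x|.
Proof. by rewrite /cabs /= expr0n/= addr0 sqrtr_sqr. Qed.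

Lemma cabs0 : cabs (0 : R[i]) = 0.
Proof. by rewrite (cabs_real 0) normr0. Qed.

Lemma cabsN z : cabs (- z) = cabs z.
Proof. by apply: complexI; rewrite -!normr_cabs normrN. Qed.

Lemma cabsD z w : cabs (z + w) <= cabs z + cabs w.
Proof. by rewrite -lecR rmorphD/= -!normr_cabs ler_normD. Qed.

Lemma cabs_subD z w : cabs z <= cabs (z - w) + cabs w.
Proof. by have := cabsD (z - w) w; rewrite subrK. Qed.

Lemma cabs_sum (u : nat -> R[i]) N :
  cabs (\sum_(0 <= n < N) u n) <= \sum_(0 <= n < N) cabs (u n).
Proof.
elim: N => [|N IH]; first by rewrite !big_geq// cabs0.
by rewrite !big_nat_recr//=; apply: (le_trans (cabsD _ _)); rewrite lerD2r.
Qed.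

Lemma Re_le_cabs z : `|complex.Re z| <= cabs z.
Proof.
case: z => x y; rewrite /cabs/= -sqrtr_sqr ler_wsqrtr// lerDl sqr_ge0//.
Qed.

Lemma Im_le_cabs z : `|complex.Im z| <= cabs z.
Proof.
case: z => x y; rewrite /cabs/= -sqrtr_sqr ler_wsqrtr// lerDr sqr_ge0//.
Qed.

Lemma cabs_le_ReIm z : cabs z <= `|complex.Re z| + `|complex.Im z|.
Proof.
rewrite [z in cabs z]complexE; apply: (le_trans (cabsD _ _)).
rewrite cabsM !cabs_real; have -> : cabs ('i : R[i]) = 1.
  by rewrite /cabs/= expr0n/= add0r expr1n sqrtr1.
by rewrite mul1r.
Qed.

(** The norm of [R[i]] takes values in [R[i]], where [0 < e] means that [e] is real and positive;
    hence real tolerances suffice. *)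
Lemma cvg_complexP T (F : set_system T) {FF : Filter F} (u : T -> R[i]^o) (l : R[i]^o) :
  u x @[x --> F] --> l <->
  (forall e : R, 0 < e -> \forall x \near F, cabs (l - u x) < e).
Proof.
split=> [/cvgrPdist_lt H e e0|H].
  have ec0 : 0 < (e%:C : R[i]) by rewrite ltcR.
  by have := H _ ec0; apply: filterS => x /=; rewrite normr_cabs ltcR.
apply/cvgrPdist_lt => e e0.
have /andP[/eqP e1 e2] : (complex.Im e == 0) && (0 < complex.Re e) by move: e0; rewrite ltcE/=.
have := H _ e2; apply: filterS => x /= lx.
by rewrite normr_cabs ltcE/= e1 eqxx.
Qed.

End ComplexModulus.

(** * Absolute convergence in the unit disc *)

Section DiscSummable.
Context {R : realType}.
Implicit Types (a : nat -> R) (r : R).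

(** Radius of convergence at least 1, tested on real radii. *)
Definition disc_summable a := forall r, 0 <= r < 1 ->
  bounded_psums (fun n => `|a n| * r ^+ n).

(** Each of the [n] powers [x^k] with [k < n] is at least [x^n], and their sum is at most
    [1 / (1 - x)]. *)
Lemma natr_mul_expr_le (x : R) n : 0 <= x < 1 -> n%:R * x ^+ n <= (1 - x)^-1.
Proof.
move=> /andP[x0 x1]; have y0 : 0 < 1 - x by rewrite subr_gt0.
have H : n%:R * x ^+ n <= \sum_(0 <= k < n) x ^+ k.
  rewrite -[n in n%:R]card_ord mulrC mulr_natr -sumr_const big_mkord.
  apply: ler_sum => i _; apply: ler_wiXn2l => //; first exact: ltW.
  by rewrite ltnW.
apply: (le_trans H); rewrite -[leRHS]mul1r ler_pdivlMr// big_mkord.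
have := subrX1 x n; have := exprn_ge0 n x0.
by move: (x ^+ n) (\sum_(i < n) _) => X S; lra.
Qed.

(** The factor [n] is absorbed by moving to the radius [s] halfway between [r] and 1, since
    [n (r / s)^n] is bounded. *)
Lemma disc_summable_natr a : disc_summable a ->
  disc_summable (fun n => n%:R * a n).
Proof.
move=> Ha r /andP[r0 r1]; pose s := (1 + r) / 2.
have s0 : 0 < s by rewrite /s; lra.
have s1 : 0 <= s < 1 by rewrite /s; apply/andP; split; lra.
have x01 : 0 <= r / s < 1.
  by rewrite divr_ge0 ?(ltW s0)//= ltr_pdivrMr// mul1r /s; lra.
have C0 : 0 <= (1 - r / s)^-1.
  by rewrite invr_ge0 subr_ge0 ltW//; case/andP: x01.
apply: le_bounded_psums C0 _ (Ha _ s1) => n.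
rewrite normrM normr_nat.
have -> : r ^+ n = (r / s) ^+ n * s ^+ n by rewrite -exprMn mulfVK// gt_eqF.
have -> : n%:R * `|a n| * ((r / s) ^+ n * s ^+ n) =
   (n%:R * (r / s) ^+ n) * (`|a n| * s ^+ n) by ring.
rewrite ler_wpM2r ?natr_mul_expr_le// mulr_ge0// exprn_ge0//.
exact: ltW.
Qed.

Lemma disc_summable_diffs a : disc_summable a -> disc_summable (pseries_diffs a).
Proof.
move=> /disc_summable_natr Ha r /andP[r0 r1]; pose s := (1 + r) / 2.
have s0 : 0 < s by rewrite /s; lra.
have s1 : 0 <= s < 1 by rewrite /s; apply/andP; split; lra.
have rs : r <= s by rewrite /s; lra.
have sV : 0 <= s^-1 by rewrite invr_ge0 ltW.
apply: le_bounded_psums sV _ ((bounded_psums_shift _).2 (Ha _ s1)) => n.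
rewrite /pseries_diffs exprS mulrCA mulKf ?gt_eqF// ler_wpM2l//.
by rewrite lerXn2r ?nnegrE// ltW.
Qed.

End DiscSummable.

(** Termwise estimates of power series yield a quadratic remainder directly. Over a general
    [numFieldType], the criterion serves complex derivatives as well as real derivatives along a
    ray. *)
Lemma is_derive_quadratic (K : numFieldType) (f : K^o -> K^o) (z d : K^o) (M e : K) :
  0 < e -> (forall h, `|h| < e -> `|(f (h + z) : K) - f z - h * d| <= M * `|h| ^+ 2) ->
  is_derive z (1 : K^o) f d.
Proof.
move=> e0 H.
suff L : h^-1 *: ((f \o shift z) (h *: (1 : K^o)) - f z) @[h --> (0 : K^o)^'] --> d.
  by apply: DeriveDef; [apply/cvg_ex; exists d|apply: cvg_lim L; exact: norm_hausdorff].
have e20 : 0 < e / 2 by rewrite divr_gt0.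
(* Testing the hypothesis at [h = e / 2] forces [M] to be nonnegative. *)
have M0 : 0 <= M.
  have e2n : `|e / 2| = e / 2 by rewrite gtr0_norm.
  have := H (e / 2); rewrite e2n ltr_pdivrMr// mulr_natr mulr2n ltrDl => /(_ e0).
  by move=> /(le_trans (normr_ge0 _)); rewrite pmulr_lge0// exprn_gt0.
have M1 : 0 < M + 1 by rewrite ltr_wpDl.
apply/cvgrPdist_lt => e1 e10.
have N1 : \forall h \near (0 : K^o)^', h != 0 by exact: nbhs_dnbhs_neq.
have N2 : \forall h \near (0 : K^o)^', `|h| < e by exact: dnbhs0_lt.
have N3 : \forall h \near (0 : K^o)^', `|h| < e1 / (M + 1).
  by apply: dnbhs0_lt; rewrite divr_gt0.
apply: filterS3 N1 N2 N3 => h h0 he he1.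
have ch0 : 0 < `|h| by rewrite normr_gt0.
rewrite /= /shift /= scaler1.
have -> : d - h^-1 *: (f (h + z) - f z) = - (h^-1 * ((f (h + z) : K) - f z - h * d)).
  by rewrite -[X in X - _](mulKf h0); rewrite /GRing.scale/=; ring.
rewrite normrN normrM normfV ltr_pdivrMl//; apply: (le_lt_trans (H _ he)).
rewrite expr2 mulrA [ltRHS]mulrC ltr_pM2r//.
apply: le_lt_trans (_ : (M + 1) * `|h| < _); last by rewrite mulrC -ltr_pdivlMr.
by rewrite ler_wpM2r// lerDl.
Qed.

Section PowerSeries.
Context {R : realType}.
Implicit Types (a : nat -> R) (z h : R[i]).

Definition psum a z N : R[i]^o := \sum_(0 <= n < N) (a n)%:C * z ^+ n.

Definition pseries_disc a : R[i]^o -> R[i]^o := power_series (fun n => (a n)%:C).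

Lemma RecD (z w : R[i]) : complex.Re (z + w) = complex.Re z + complex.Re w.
Proof. by case: z w => [? ?] [? ?]. Qed.

Lemma ImcD (z w : R[i]) : complex.Im (z + w) = complex.Im z + complex.Im w.
Proof. by case: z w => [? ?] [? ?]. Qed.

Lemma RecB (z w : R[i]) : complex.Re (z - w) = complex.Re z - complex.Re w.
Proof. by case: z w => [? ?] [? ?]. Qed.

Lemma ImcB (z w : R[i]) : complex.Im (z - w) = complex.Im z - complex.Im w.
Proof. by case: z w => [? ?] [? ?]. Qed.

Lemma RecMl (x : R) z : complex.Re (x%:C * z) = x * complex.Re z.
Proof. by case: z => u v; rewrite /= mul0r subr0. Qed.

Lemma ImcMl (x : R) z : complex.Im (x%:C * z) = x * complex.Im z.
Proof. by case: z => u v; rewrite /= mul0r addr0. Qed.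

Lemma Re_psum a z N :
  complex.Re (psum a z N) = \sum_(0 <= n < N) a n * complex.Re (z ^+ n).
Proof.
rewrite /psum; elim: N => [|N IH]; first by rewrite !big_geq.
by rewrite !big_nat_recr//= RecD IH RecMl.
Qed.

Lemma Im_psum a z N :
  complex.Im (psum a z N) = \sum_(0 <= n < N) a n * complex.Im (z ^+ n).
Proof.
rewrite /psum; elim: N => [|N IH]; first by rewrite !big_geq.
by rewrite !big_nat_recr//= ImcD IH ImcMl.
Qed.

Lemma cabs_psum_le a z N :
  cabs (psum a z N) <= \sum_(0 <= n < N) `|a n| * cabs z ^+ n.
Proof.
apply: (le_trans (cabs_sum _ _)).
by under eq_bigr do rewrite cabsM cabsX cabs_real.
Qed.

Lemma psum_real a (r : R) N : psum a r%:C N = (\sum_(0 <= n < N) a n * r ^+ n)%:C.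
Proof.
rewrite /psum; elim: N => [|N IH]; first by rewrite !big_geq.
by rewrite !big_nat_recr//= IH rmorphD rmorphM rmorphXn.
Qed.

Lemma bounded_psums_cvg (u v : nat -> R) : (forall n, `|u n| <= v n) ->
  bounded_psums v -> cvgn (series u).
Proof.
move=> uv [M vM]; apply: normed_cvg; apply: nondecreasing_is_cvgn.
  by apply/nondecreasing_seqP => n; rewrite /normed_series_of /series/= big_nat_recr//= lerDl.
exists M => _ [n _ <-]; apply: le_trans (vM n).
by apply: ler_sum_nat => k _; exact: uv.
Qed.

Lemma psum_cvg a z : disc_summable a -> cabs z < 1 ->
  psum a z @ \oo --> pseries_disc a z.
Proof.
move=> Ha z1; have Hz := Ha (cabs z); rewrite cabs_ge0 z1 in Hz.
have {}Hz := Hz isT.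
have cR : cvgn (series (fun n => a n * complex.Re (z ^+ n))).
  apply: bounded_psums_cvg Hz => n.
  by rewrite normrM -cabsX ler_wpM2l// Re_le_cabs.
have cI : cvgn (series (fun n => a n * complex.Im (z ^+ n))).
  apply: bounded_psums_cvg Hz => n.
  by rewrite normrM -cabsX ler_wpM2l// Im_le_cabs.
pose L : R[i]^o := limn (series (fun n => a n * complex.Re (z ^+ n))) +i*
  limn (series (fun n => a n * complex.Im (z ^+ n))).
suff HL : psum a z @ \oo --> L.
  by rewrite /pseries_disc /power_series; rewrite (cvg_lim _ HL)//; exact: norm_hausdorff.
apply/cvg_complexP => e e0.
have e20 : 0 < e / 2 by rewrite divr_gt0.
move/cvgrPdist_lt : cR => /(_ _ e20); move/cvgrPdist_lt : cI => /(_ _ e20).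
apply: filterS2 => n; rewrite /series/= -Re_psum -Im_psum => h1 h2.
apply: (le_lt_trans (cabs_le_ReIm _)).
rewrite RecB ImcB /L/=; lra.
Qed.

Lemma cvg_cabs_le (u : nat -> R[i]^o) (l : R[i]^o) (M : R) :
  u @ \oo --> l -> (forall n, cabs (u n) <= M) -> cabs l <= M.
Proof.
move=> /cvg_complexP H uM; apply/ler_addgt0Pr => e e0.
have [n _ /(_ n (leqnn n)) /= ln] := H _ e0.
rewrite -[l](subrK (u n)); apply: (le_trans (cabsD _ _)).
by rewrite addrC lerD// ltW.
Qed.

Lemma cvg_Re_ge (u : nat -> R[i]^o) (l : R[i]^o) (m : R) :
  u @ \oo --> l -> (\forall n \near \oo, m <= complex.Re (u n)) -> m <= complex.Re l.
Proof.
move=> /cvg_complexP H um; apply/ler_addgt0Pr => e e0.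
have [n _ /(_ n (leqnn n)) /=] := filterI um (H _ e0).
move=> [mu ln]; have := Re_le_cabs (l - u n); rewrite ler_norml => /andP[+ _].
by rewrite RecB; lra.
Qed.

Lemma cabs_pseries_le a z (M : R) : disc_summable a -> cabs z < 1 ->
  (forall N, cabs (psum a z N) <= M) -> cabs (pseries_disc a z) <= M.
Proof. by move=> Ha z1; apply: cvg_cabs_le; exact: psum_cvg. Qed.

Lemma pseries_radial_ge a (r : R) N : disc_summable a -> (forall n, 0 <= a n) ->
  0 <= r < 1 -> \sum_(0 <= n < N) a n * r ^+ n <= cabs (pseries_disc a r%:C).
Proof.
move=> Ha a0 /andP[r0 r1].
apply: le_trans (le_trans (ler_norm _) (Re_le_cabs _)).
apply: (cvg_Re_ge (psum_cvg Ha _)); first by rewrite cabs_real ger0_norm.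
near=> M; rewrite psum_real/= (@big_cat_nat _ _ _ N 0 M)//=; last by near: M; exact: nbhs_infty_ge.
by rewrite lerDl sumr_ge0// => n _; rewrite mulr_ge0 ?exprn_ge0.
Unshelve. all: by end_near. Qed.

Lemma pseries_radial_le a (r M : R) : disc_summable a -> (forall n, 0 <= a n) ->
  0 <= r < 1 -> (forall N, \sum_(0 <= n < N) a n * r ^+ n <= M) ->
  cabs (pseries_disc a r%:C) <= M.
Proof.
move=> Ha a0 /andP[r0 r1] H; apply: cabs_pseries_le => // [|N].
  by rewrite cabs_real ger0_norm.
rewrite psum_real cabs_real ger0_norm// sumr_ge0// => n _.
by rewrite mulr_ge0 ?exprn_ge0.
Qed.

Lemma pseries_le_radial a z (r : R) : disc_summable a -> (forall n, 0 <= a n) ->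
  cabs z <= r -> r < 1 -> cabs (pseries_disc a z) <= cabs (pseries_disc a r%:C).
Proof.
move=> Ha a0 zr r1; have r0 : 0 <= r := le_trans (cabs_ge0 _) zr.
apply: cabs_pseries_le => // [|N]; first exact: le_lt_trans r1.
apply: (le_trans (cabs_psum_le _ _ _)); apply: le_trans (pseries_radial_ge N Ha a0 _).
  apply: ler_sum_nat => n _; rewrite ger0_norm// ler_wpM2l// lerXn2r ?nnegrE//.
  exact: cabs_ge0.
by rewrite r0.
Qed.

(** The remainder [E_n] satisfies [E_(n+1) = (z + h) E_n + h^2 n z^(n-1)], and
    [n^2 + n <= (n + 1)^2] closes the induction. The factor [r ^ 2] on the left avoids the exponent
    [n - 2]. *)
Lemma exprB_quadratic z h (r : R) n : 0 < r -> cabs z <= r -> cabs (z + h) <= r ->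
  r ^+ 2 * cabs ((z + h) ^+ n - z ^+ n - h * (n%:R * z ^+ n.-1)) <=
  cabs h ^+ 2 * (n%:R ^+ 2 * r ^+ n).
Proof.
move=> r0 zr zhr; elim: n => [|n IH].
  by rewrite !expr0 subrr mul0r mulr0 subr0 cabs0 mulr0 expr0n/= mul0r mulr0.
have -> : (z + h) ^+ n.+1 - z ^+ n.+1 - h * (n.+1%:R * z ^+ n) =
    (z + h) * ((z + h) ^+ n - z ^+ n - h * (n%:R * z ^+ n.-1)) +
    h ^+ 2 * (n%:R * z ^+ n.-1).
  case: n {IH} => [|n] /=; first by rewrite !expr1 !expr0; ring.
  by rewrite !(exprS _ n.+1) !(exprS z n) -(natr1 n.+1); ring.
apply: (le_trans (ler_wpM2l _ (cabsD _ _))); first exact: sqr_ge0.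
rewrite mulrDr [cabs ((z + h) * _)]cabsM [cabs (h ^+ 2 * _)]cabsM (cabsX h) [cabs (n%:R * _)]cabsM.
have h1 : r ^+ 2 * (cabs (z + h) *
      cabs ((z + h) ^+ n - z ^+ n - h * (n%:R * z ^+ n.-1))) <=
    r * (cabs h ^+ 2 * (n%:R ^+ 2 * r ^+ n)).
  rewrite mulrCA; apply: ler_pM => //; first exact: cabs_ge0.
  by rewrite mulr_ge0 ?sqr_ge0// cabs_ge0.
have h2 : r ^+ 2 * (cabs h ^+ 2 * (cabs n%:R * cabs (z ^+ n.-1))) <=
    r * (cabs h ^+ 2 * (n%:R * r ^+ n)).
  have -> : cabs (n%:R : R[i]) = n%:R :> R.
    by rewrite -[in LHS](rmorph_nat (real_complex R)) cabs_real normr_nat.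
  case: n {IH h1} => [|n] /=; first by rewrite !mul0r !mulr0.
  rewrite cabsX expr2 -mulrA ler_wpM2l ?(ltW r0)// mulrCA ler_wpM2l ?sqr_ge0//.
  rewrite mulrCA ler_wpM2l// [in leRHS]exprS ler_wpM2l ?(ltW r0)//.
  by rewrite lerXn2r ?nnegrE ?cabs_ge0 ?(ltW r0).
apply: (le_trans (lerD h1 h2)); rewrite -natr1 (exprS r n).
have n0 : 0 <= n%:R :> R by [].
have rn : 0 <= r ^+ n by rewrite exprn_ge0// ltW.
have hh : 0 <= cabs h ^+ 2 by exact: sqr_ge0.
have := mulr_ge0 hh (mulr_ge0 (ltW r0) (mulr_ge0 rn (addr_ge0 n0 ler01))).
by move: (cabs h ^+ 2) (r ^+ n) (n%:R : R) => x y w; lra.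
Qed.

Lemma cvg_cabs_le_quotient (u v w : nat -> R[i]^o) (l m n : R[i]^o) h (M : R) :
  u @ \oo --> l -> v @ \oo --> m -> w @ \oo --> n ->
  (forall N, cabs ((u N : R[i]) - v N - h * w N) <= M) ->
  cabs ((l : R[i]) - m - h * n) <= M.
Proof.
move=> /cvg_complexP Hu /cvg_complexP Hv /cvg_complexP Hw H.
apply/ler_addgt0Pr => e e0.
have h1 : 0 < cabs h + 1 by rewrite ltr_wpDl// cabs_ge0.
have e3 : 0 < e / 3 by rewrite divr_gt0.
have [N _ /(_ N (leqnn N)) /= [[lu mv] nw]] :=
  filterI (filterI (Hu _ e3) (Hv _ e3)) (Hw _ (divr_gt0 e3 h1)).
have -> : (l : R[i]) - m - h * n = (((u N : R[i]) - v N - h * w N) +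
    (l - u N)) + (- (m - v N) + - (h * (n - w N))) by ring.
apply: (le_trans (cabsD _ _)); apply: (le_trans (lerD (cabsD _ _) (cabsD _ _))).
rewrite !cabsN cabsM.
have : cabs h * cabs (n - w N) <= e / 3.
  move: nw; rewrite ltr_pdivlMr// => /ltW; apply: le_trans.
  by rewrite mulrC ler_wpM2l ?cabs_ge0// lerDl.
by have := H N; lra.
Qed.

Lemma psum_quadratic a z h (r : R) N : 0 < r -> cabs z <= r -> cabs (z + h) <= r ->
  cabs ((psum a (z + h) N.+1 : R[i]) - psum a z N.+1 - h * psum (pseries_diffs a) z N) <=
  cabs h ^+ 2 * (r ^- 2 * \sum_(0 <= n < N.+1) `|n%:R * (n%:R * a n)| * r ^+ n).
Proof.
move=> r0 zr zhr.
have -> : psum (pseries_diffs a) z N =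
    \sum_(0 <= n < N.+1) (a n)%:C * (n%:R * z ^+ n.-1) :> R[i].
  rewrite big_nat_recl//= mul0r mulr0 add0r; apply: eq_bigr => n _.
  by rewrite /pseries_diffs rmorphM rmorph_nat; ring.
rewrite /psum mulr_sumr -!sumrB; apply: (le_trans (cabs_sum _ _)).
rewrite mulr_sumr mulr_sumr; apply: ler_sum_nat => n _.
rewrite mulrCA -!mulrBr cabsM cabs_real.
have r2 : 0 < r ^+ 2 by rewrite exprn_gt0.
rewrite [leRHS]mulrCA ler_pdivlMl// [leLHS]mulrCA.
apply: (le_trans (ler_wpM2l _ (exprB_quadratic n r0 zr zhr))) => //.
rewrite !normrM normr_nat le_eqVlt; apply/orP; left; apply/eqP.
by rewrite (expr2 n%:R); ring.
Qed.

Lemma is_derive_quadratic_complex (f : R[i]^o -> R[i]^o) (z d : R[i]^o) (M e : R) :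
  0 < e -> (forall h, cabs h < e -> cabs ((f (h + z) : R[i]) - f z - h * d) <= M * cabs h ^+ 2) ->
  is_derive z (1 : R[i]^o) f d.
Proof.
move=> e0 H; apply: (@is_derive_quadratic _ _ _ _ M%:C e%:C); first by rewrite ltcR.
move=> h; rewrite !normr_cabs ltcR => /H.
by rewrite -rmorphXn -rmorphM lecR.
Qed.

(** The quantitative form gives the complex derivative and, for [h] a real multiple of a fixed [w],
    the real derivatives of real and imaginary parts along a ray. *)
Lemma pseries_disc_quadratic a z : disc_summable a -> cabs z < 1 ->
  exists M e, 0 < e /\ forall h, cabs h < e ->
    cabs ((pseries_disc a (h + z) : R[i]) - pseries_disc a z -
      h * pseries_disc (pseries_diffs a) z) <= M * cabs h ^+ 2.
Proof.
move=> Ha z1; pose r := (1 + cabs z) / 2.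
have z0 := cabs_ge0 z.
have r0 : 0 < r by rewrite /r; lra.
have r1 : 0 <= r < 1 by rewrite /r; apply/andP; split; lra.
have [M HM] := disc_summable_natr (disc_summable_natr Ha) r1.
exists (r ^- 2 * M), (r - cabs z); split; first by rewrite /r; lra.
move=> h hr; rewrite (addrC h).
have zr : cabs z <= r by rewrite /r; lra.
have zhr : cabs (z + h) <= r by apply: (le_trans (cabsD _ _)); lra.
have zh1 : cabs (z + h) < 1 by apply: le_lt_trans zhr _; case/andP: r1.
have c1 : (fun N => psum a (z + h) N.+1) @ \oo --> pseries_disc a (z + h).
  by rewrite (cvg_shiftS (psum a (z + h))); exact: psum_cvg.
have c2 : (fun N => psum a z N.+1) @ \oo --> pseries_disc a z.
  by rewrite (cvg_shiftS (psum a z)); exact: psum_cvg.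
apply: (cvg_cabs_le_quotient c1 c2 (psum_cvg (disc_summable_diffs Ha) z1)).
move=> N; apply: (le_trans (psum_quadratic a N r0 zr zhr)).
rewrite [leRHS]mulrC ler_wpM2l ?sqr_ge0// ler_wpM2l ?HM// invr_ge0 exprn_ge0//.
exact: ltW.
Qed.

Lemma is_derive_pseries_disc a z : disc_summable a -> cabs z < 1 ->
  is_derive (z : R[i]^o) (1 : R[i]^o) (pseries_disc a)
    (pseries_disc (pseries_diffs a) z).
Proof.
move=> Ha z1; have [M [e [e0 H]]] := pseries_disc_quadratic Ha z1.
exact: is_derive_quadratic_complex e0 H.
Qed.

Lemma derive1n_pseries_disc a n z : disc_summable a -> cabs z < 1 ->
  derive1n n (pseries_disc a) z = pseries_disc (iter n (@pseries_diffs R) a) z.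
Proof.
move=> Ha; have Hn k : disc_summable (iter k (@pseries_diffs R) a).
  by elim: k => //= k IH; exact: disc_summable_diffs.
elim: n z => [//|n IH] z z1.
rewrite derive1nS derive1E.
(* The induction hypothesis holds only inside the disc, hence in a neighbourhood of [z], which is
   all that the derivative at [z] depends on. *)
rewrite (@near_eq_derive _ _ _ _ (pseries_disc (iter n (@pseries_diffs R) a))).
  by rewrite (@derive_val _ _ _ _ _ _ _ (is_derive_pseries_disc (Hn n) z1)).
have e0 : 0 < 1 - cabs z by rewrite subr_gt0.
have /cvg_complexP/(_ _ e0) : id w @[w --> (z : R[i]^o)] --> (z : R[i]^o).
  exact: cvg_id.
apply: filterS => w /= zw; apply: IH.
have -> : w = z - (z - w) by rewrite subKr.
by apply: (le_lt_trans (cabsD _ _)); rewrite cabsN; lra.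
Qed.

Lemma pseries_disc0 a : disc_summable a -> pseries_disc a 0 = (a 0%N)%:C.
Proof.
move=> Ha; apply: cvg_lim; first exact: norm_hausdorff.
rewrite -(cvg_shiftS (series _)); apply: cvg_near_cst; near=> n.
rewrite /series/= big_nat_recl//= expr0 mulr1 big1 ?addr0// => i _.
by rewrite expr0n/= mulr0.
Unshelve. all: by end_near. Qed.

Lemma iter_pseries_diffs a n k :
  k`!%:R * iter n (@pseries_diffs R) a k = (n + k)`!%:R * a (n + k)%N.
Proof.
elim: n k => [//|n IH] k /=.
rewrite /pseries_diffs mulrA -natrM mulnC -factS IH.
by rewrite addnS addSn.
Qed.

(** [frac_deriv] reads the coefficients of its argument through iterated derivatives at 0; this
    recovers the moments from [F_mu]. *)
Lemma taylor_coef_pseries_disc a n : disc_summable a ->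
  taylor_coef (pseries_disc a) n = (a n)%:C.
Proof.
move=> Ha; rewrite /taylor_coef derive1n_pseries_disc ?cabs0//.
rewrite pseries_disc0; last first.
  by elim: n => //= n IH; exact: disc_summable_diffs.
have := iter_pseries_diffs a n 0; rewrite fact0 mul1r addn0 => ->.
rewrite rmorphM rmorph_nat mulrC mulKf//.
Qed.

Lemma analytic_pseries_disc a : disc_summable a -> analytic_on_disc (pseries_disc a).
Proof.
by move=> Ha z z1; case: (is_derive_pseries_disc Ha z1).
Qed.

End PowerSeries.

(** * The binomial series *)

Section BinomialSeries.
Context {R : realType}.
Implicit Types (w : R[i]).

Lemma is_derive_pseries_ray (a : nat -> R) w (x : R) : disc_summable a ->
  cabs (x%:C * w) < 1 ->
  is_derive x 1 (fun x : R => complex.Re (pseries_disc a (x%:C * w)))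
    (complex.Re (w * pseries_disc (pseries_diffs a) (x%:C * w))) /\
  is_derive x 1 (fun x : R => complex.Im (pseries_disc a (x%:C * w)))
    (complex.Im (w * pseries_disc (pseries_diffs a) (x%:C * w))).
Proof.
move=> Ha xw; have [M [e [e0 H]]] := pseries_disc_quadratic Ha xw.
have w1 : 0 < cabs w + 1 by rewrite ltr_wpDl// cabs_ge0.
have d0 : 0 < e / (cabs w + 1) by rewrite divr_gt0.
have K (h : R) : `|h| < e / (cabs w + 1) ->
    cabs ((pseries_disc a ((h + x)%:C * w) : R[i]) - pseries_disc a (x%:C * w) -
     h%:C * (w * pseries_disc (pseries_diffs a) (x%:C * w))) <=
    M * cabs w ^+ 2 * `|h| ^+ 2.
  rewrite ltr_pdivlMr// => hw.
  have /H : cabs (h%:C * w) < e.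
    rewrite cabsM cabs_real; apply: le_lt_trans hw.
    by rewrite ler_wpM2l// lerDl.
  rewrite cabsM cabs_real rmorphD/= mulrDl mulrA exprMn.
  by rewrite -(mulrA M) (mulrC (cabs w ^+ 2)).
split; apply: (is_derive_quadratic d0) => h /K; apply: le_trans.
  apply: le_trans (Re_le_cabs _); rewrite !RecB RecMl//.
by apply: le_trans (Im_le_cabs _); rewrite !ImcB ImcMl.
Qed.

Variables (alpha : R) (c : nat -> R).
Hypotheses (alpha_gt : -1 < alpha) (c0 : c 0%N = 1).
Hypothesis cS : forall n, n.+1%:R * c n.+1 = (n%:R + alpha + 1) * c n.

(** Once [N (1 - r) >= 2 (1 + alpha)], [truncation_le] bounds every partial sum by twice the one of
    length [N]. *)
Lemma binomial_disc_summable (mu : nat -> R) : (forall n, 0 <= mu n) ->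
  {homo mu : n k / (n <= k)%N >-> k <= n} -> disc_summable (fun n => c n * mu n).
Proof.
move=> mu0 mud r /andP[r0 r1]; have a1 := alpha_gt.
have r01 : 0 <= r <= 1 by rewrite r0 ltW.
have y0 : 0 < 1 - r by rewrite subr_gt0.
pose N := (Num.truncn (2 * (1 + alpha) / (1 - r))).+1.
have HN : 2 * (1 + alpha) <= N%:R * (1 - r).
  by rewrite -ler_pdivrMr// ltW// truncnS_gt.
exists (2 * \sum_(0 <= n < N) c n * mu n * r ^+ n) => M.
under eq_bigr do rewrite ger0_norm ?mulr_ge0 ?(ltW (binomial_coef_gt0 alpha_gt c0 cS _))//.
exact: (truncation_le alpha_gt c0 cS mu0 mud M r01 HN).
Qed.

Lemma binomial_summable : disc_summable c.
Proof.
have -> : c = (fun n => c n * (fun=> 1) n) by apply: funext => n; rewrite mulr1.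
exact: binomial_disc_summable.
Qed.

(** Summing the recursion gives [G' = w G' + (1 + alpha) G]. It is exact for partial sums when
    [w G'] is cut one index earlier than the other two, and it passes to the limit. *)
Lemma binomial_series_ode w : cabs w < 1 ->
  (1 - w) * pseries_disc (pseries_diffs c) w = (1 + alpha)%:C * (pseries_disc c w : R[i]).
Proof.
move=> w1; have Hc := binomial_summable; have Hd := disc_summable_diffs Hc.
have cv1 := psum_cvg Hd w1.
have cv2 : psum (pseries_diffs c) w N.+1 @[N --> \oo] --> pseries_disc (pseries_diffs c) w.
  by rewrite (cvg_shiftS (psum (pseries_diffs c) w)).
have cv3 : psum c w N.+1 @[N --> \oo] --> pseries_disc c w.
  by rewrite (cvg_shiftS (psum c w)); exact: psum_cvg.
have E N : (psum (pseries_diffs c) w N.+1 : R[i]) = w * psum (pseries_diffs c) w N +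
    (1 + alpha)%:C * psum c w N.+1.
  have -> : w * psum (pseries_diffs c) w N = \sum_(0 <= n < N.+1) (n%:R * c n)%:C * w ^+ n.
    rewrite big_nat_recl//= mul0r mul0r add0r /psum mulr_sumr.
    by apply: eq_bigr => n _; rewrite exprS /pseries_diffs; ring.
  rewrite /psum mulr_sumr -big_split/=; apply: eq_bigr => n _.
  rewrite /pseries_diffs cS mulrA -mulrDl -rmorphM -rmorphD; congr (_%:C * _).
  by ring.
suff H : forall e : R, 0 < e -> cabs ((1 - w) * pseries_disc (pseries_diffs c) w -
     (1 + alpha)%:C * pseries_disc c w) <= e.
  apply/eqP; rewrite -subr_eq0; apply/eqP; apply: ComplexField.Normc.eq0_normc.
  apply/eqP; rewrite eq_le [X in _ && X]cabs_ge0 andbT.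
  by apply/ler_addgt0Pr => e /H; rewrite add0r.
move=> e e0.
move/cvg_complexP : cv1 => cv1; move/cvg_complexP : cv2 => cv2.
move/cvg_complexP : cv3 => cv3.
have a0 : 0 < `|1 + alpha| + 1 by rewrite ltr_wpDl.
have e3 : 0 < e / 3 by rewrite divr_gt0.
have [N _ /(_ N (leqnn N)) /= [[h1 h2] h3]] :=
  filterI (filterI (cv1 _ e3) (cv2 _ e3)) (cv3 _ (divr_gt0 e3 a0)).
have -> : (1 - w) * pseries_disc (pseries_diffs c) w -
     (1 + alpha)%:C * (pseries_disc c w : R[i]) =
   ((pseries_disc (pseries_diffs c) w : R[i]) - psum (pseries_diffs c) w N.+1) -
   w * ((pseries_disc (pseries_diffs c) w : R[i]) - psum (pseries_diffs c) w N) -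
   (1 + alpha)%:C * ((pseries_disc c w : R[i]) - psum c w N.+1).
  by rewrite E; ring.
apply: (le_trans (cabsD _ _)); apply: (le_trans (lerD (cabsD _ _) (lexx _))).
rewrite !cabsN !cabsM cabs_real.
have k1 : cabs w * cabs ((pseries_disc (pseries_diffs c) w : R[i]) -
    psum (pseries_diffs c) w N) <= e / 3.
  apply: le_trans (ltW h1); rewrite ler_piMl ?cabs_ge0//; exact: ltW.
have k2 : `|1 + alpha| * cabs ((pseries_disc c w : R[i]) - psum c w N.+1) <= e / 3.
  move: h3; rewrite ltr_pdivlMr// => /ltW; apply: le_trans.
  by rewrite mulrC ler_wpM2l ?cabs_ge0// lerDl.
by lra.
Qed.


Lemma cabs_sqr (z : R[i]) : cabs z ^+ 2 = complex.Re z ^+ 2 + complex.Im z ^+ 2.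
Proof. by case: z => x y; rewrite /cabs/= sqr_sqrtr// addr_ge0// sqr_ge0. Qed.

(* Along the ray x w both |1 - x w|^2 and |G (x w)|^2 are differentiable, and by
   (1 - z) G' = (1 + alpha) G their weighted product has derivative 0. *)
Lemma cabs_binomial_series w : cabs w < 1 ->
  cabs (pseries_disc c w) * cabs (1 - w) `^ (1 + alpha) = 1.
Proof.
move=> w1; have Hc := binomial_summable; have a1 := alpha_gt.
set s := 1 + alpha; have s0 : 0 < s by rewrite /s; lra.
set p := complex.Re w; set q := complex.Im w.
pose u x := complex.Re (pseries_disc c (x%:C * w)).
pose v x := complex.Im (pseries_disc c (x%:C * w)).
pose u' x := complex.Re (w * pseries_disc (pseries_diffs c) (x%:C * w)).
pose v' x := complex.Im (w * pseries_disc (pseries_diffs c) (x%:C * w)).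
pose D (x : R) := (1 - x * p) ^+ 2 + (x * q) ^+ 2.
have xw1 (x : R) : x \in `[0, 1] -> cabs (x%:C * w) < 1.
  rewrite in_itv/= => /andP[x0 x1]; rewrite cabsM cabs_real ger0_norm//.
  by apply: le_lt_trans w1; rewrite ler_piMl// cabs_ge0.
have ReD x : complex.Re (1 - x%:C * w) = 1 - x * p by rewrite RecB RecMl /p; case: (w).
have ImD x : complex.Im (1 - x%:C * w) = - (x * q) by rewrite ImcB ImcMl sub0r.
have DE x : D x = cabs (1 - x%:C * w) ^+ 2.
  by rewrite cabs_sqr ReD ImD sqrrN.
have D0 x : x \in `[0, 1] -> 0 < D x.
  move=> /xw1 xw; rewrite DE exprn_gt0//.
  have := cabsD (1 - x%:C * w) (x%:C * w); rewrite subrK.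
  have -> : cabs (1 : R[i]) = 1 by rewrite (cabs_real (1 : R)) normr1.
  by lra.
have ode x : x \in `[0, 1] ->
    (1 - x * p) * u' x + x * q * v' x = s * (p * u x - q * v x) /\
    (1 - x * p) * v' x - x * q * u' x = s * (p * v x + q * u x).
  move=> /xw1 /binomial_series_ode H.
  have {}H : (1 - x%:C * w) * (w * pseries_disc (pseries_diffs c) (x%:C * w)) =
    s%:C * (w * (pseries_disc c (x%:C * w) : R[i])).
    by rewrite mulrCA H mulrCA.
  move: H; rewrite /u' /v' /u /v /p /q.
  move: (w * pseries_disc (pseries_diffs c) (x%:C * w)) => [u1 v1].
  move: (pseries_disc c (x%:C * w)) => [u0 v0]; case: (w) => p0 q0.
  move=> /= [h1 h2]; split; [move: h1|move: h2]; lra.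
pose h x := (u x * u x + v x * v x) * D x `^ s.
pose D' x := - 2 * p * (1 - x * p) + 2 * q * (x * q).
have dD (x : R) : is_derive x (1 : R) D (D' x).
  apply: (@is_derive_quadratic _ _ _ _ (p ^+ 2 + q ^+ 2) 1) => // k _.
  have -> : D (k + x) - D x - k * D' x = (p ^+ 2 + q ^+ 2) * k ^+ 2.
    by rewrite /D /D'; ring.
  by rewrite normrM normrX ger0_norm// addr_ge0// sqr_ge0.
have dh (x : R) : x \in `[0, 1] -> is_derive x (1 : R) h 0.
  move=> x01; have [du dv] := is_derive_pseries_ray Hc (xw1 _ x01).
  have [e1 e2] := ode _ x01.
  have dpow : is_derive (D x) (1 : R) (@powR R ^~ s) (s * D x `^ (s - 1)).
    have Dx : D x \in `]0, +oo[ by rewrite in_itv/= andbT D0.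
    by apply: DeriveDef; [exact: derivable_powR|rewrite -derive1E powR_derive1].
  have dDs := is_derive1_comp dpow (dD x).
  have dM : is_derive x (1 : R) h
      ((u x * u x + v x * v x) * (s * D x `^ (s - 1) * D' x) +
       D x `^ s * (u x * u' x + u x * u' x + (v x * v' x + v x * v' x))).
    exact: is_deriveM (is_deriveD (is_deriveM du du) (is_deriveM dv dv)) dDs.
  apply: (is_derive_eq dM).
  rewrite -(mulr_powRB1 (ltW (D0 _ x01)) s0).
  (* The two real equations in [ode] are solved for [u' x] and [v' x] by Cramer's rule; their
     determinant is [D x]. *)
  have key : D x * (u x * u' x + v x * v' x) =
      u x * ((1 - x * p) * (s * (p * u x - q * v x)) -
             x * q * (s * (p * v x + q * u x))) +
      v x * (x * q * (s * (p * u x - q * v x)) +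
             (1 - x * p) * (s * (p * v x + q * u x))).
    by rewrite -e1 -e2 /D; ring.
  transitivity (D x `^ (s - 1) * ((u x * u x + v x * v x) * (s * D' x) +
     2 * (D x * (u x * u' x + v x * v' x)))); first by ring.
  by rewrite key /D'; ring.
have h01 : h 1 = h 0.
  have hd (x : R) : x \in `]0, 1[ -> is_derive x (1 : R) h (cst (0 : R) x).
    by move=> /subset_itv_oo_cc; exact: dh.
  have hc : {within `[(0 : R), 1], continuous h}.
    by apply: derivable_within_continuous => x /dh [].
  have [x x01] := MVT_segment ler01 hd hc.
  by rewrite mul0r => /eqP; rewrite subr_eq0 => /eqP.
have : (cabs (pseries_disc c w) * cabs (1 - w) `^ s) ^+ 2 = 1.
  have h0 : h 0 = 1.
    rewrite /h /u /v /D !mul0r subr0 expr1n expr0n/= addr0 powR1 mulr1.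
    by rewrite pseries_disc0// c0/= mulr0 addr0 mulr1.
  have h1 : h 1 = cabs (pseries_disc c w) ^+ 2 * (cabs (1 - w) `^ s) ^+ 2.
    rewrite /h /u /v DE rmorph1 mul1r powR_exprAC ?cabs_ge0//.
    by rewrite (cabs_sqr (pseries_disc c w)) -!expr2.
  by rewrite exprMn -h1 h01.
move=> /eqP; rewrite -[X in _ == X](expr1n _ 2) eqrXn2// => [/eqP//|].
by rewrite mulr_ge0 ?powR_ge0 ?cabs_ge0.
Qed.

End BinomialSeries.

(** * Moments and pointwise bounds *)

Section Moments.
Context {R : realType}.
Variable mu : {finite_measure set (measurableTypeR R) -> \bar R}.

Lemma integrable_expr n :
  mu.-integrable `[(0 : R), 1[ (EFin \o (fun t : R => t ^+ n)).
Proof.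
apply: measurable_bounded_integrable => //.
- by rewrite ltey_eq fin_num_measure.
- exists 1; split; first exact: num_real.
  move=> x x1 t /=; rewrite in_itv/= => /andP[t0 t1].
  rewrite normrX ger0_norm//; apply: le_trans (ltW x1).
  by rewrite exprn_ile1// ltW.
Qed.

Lemma moment_ge0 n : 0 <= moment mu n.
Proof.
by apply: Rintegral_ge0 => t /=; rewrite in_itv/= => /andP[t0 _]; exact: exprn_ge0.
Qed.

Lemma moment_decreasing : {homo moment mu : n k / (n <= k)%N >-> k <= n}.
Proof.
move=> n k nk; apply: le_Rintegral; rewrite ?measurable_itv//.
- exact: integrable_expr.
- exact: integrable_expr.
move=> t /=; rewrite in_itv/= => /andP[t0 t1].
by apply: ler_wiXn2l => //; exact: ltW.
Qed.

(** Positivity of the integral on polynomials, in terms of moments. The constant [e] is kept apart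
    from the coefficients because it will carry a truncation error. *)
Lemma moment_poly_ge0 (e : R) (k : nat -> R) N :
  (forall t, 0 <= t < 1 -> 0 <= e + \sum_(0 <= n < N) k n * t ^+ n) ->
  0 <= e * moment mu 0 + \sum_(0 <= n < N) k n * moment mu n.
Proof.
move=> H.
pose P M (t : R) : R := e * t ^+ 0 + \sum_(0 <= n < M) k n * t ^+ n.
have PS M : P M.+1 = (fun t => P M t + k M * t ^+ M).
  by apply: funext => t; rewrite /P big_nat_recr//= addrA.
have P0 : P 0%N = (fun t => e * t ^+ 0).
  by apply: funext => t; rewrite /P big_geq// addr0.
have mI : measurable (`[(0 : R), 1[ : set (measurableTypeR R)) by exact: measurable_itv.
have intZ (a : R) n : mu.-integrable `[(0 : R), 1[ (EFin \o (fun t : R => a * t ^+ n)).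
  exact: integrableZl (integrable_expr n).
have [_ <-] : mu.-integrable `[(0 : R), 1[ (EFin \o P N) /\
    \int[mu]_(t in `[(0 : R), 1[) P N t =
    e * moment mu 0 + \sum_(0 <= n < N) k n * moment mu n.
  elim: N {H} => [|N [IH1 IH2]].
    rewrite P0 big_geq// addr0; split; first exact: intZ.
    by rewrite RintegralZl//; exact: integrable_expr.
  rewrite PS; split.
    exact: (integrableD mI IH1 (intZ _ _)).
  rewrite (RintegralD mI IH1 (intZ _ _)).
  rewrite IH2 big_nat_recr//= addrA RintegralZl//.
  exact: integrable_expr.
apply: Rintegral_ge0 => t /=; rewrite in_itv/= => t01.
by rewrite /P expr0 mulr1; exact: H.
Qed.

End Moments.

(** * Distance from 1 to points of a circle *)

Section CircleDistance.
Context {R : realType}.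
Implicit Types (r t theta m : R).

Lemma circle_ptM t r theta : t%:C * circle_pt r theta = circle_pt (t * r) theta.
Proof. by rewrite /circle_pt mulrA -rmorphM. Qed.

Lemma cabs_circle_pt r theta : cabs (circle_pt r theta) = `|r|.
Proof.
rewrite /circle_pt cabsM cabs_real.
have -> : cabs (cos theta +i* sin theta) = 1.
  by rewrite /cabs/= cos2Dsin2 sqrtr1.
by rewrite mulr1.
Qed.

Lemma circle_ptX r theta n :
  circle_pt r theta ^+ n = (r ^+ n)%:C * (cos (n%:R * theta) +i* sin (n%:R * theta)).
Proof.
rewrite /circle_pt exprMn -rmorphXn; congr (_ * _).
elim: n => [|n IH]; first by rewrite expr0 mul0r cos0 sin0.
rewrite exprS IH -natr1 mulrDl mul1r cosD sinD.
by congr (_ +i* _); ring.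
Qed.

Lemma sqr_cabs_1Bcircle s theta :
  cabs (1 - circle_pt s theta) ^+ 2 = (1 - s) ^+ 2 + 4 * s * sin (theta / 2) ^+ 2.
Proof.
rewrite cabs_sqr RecB ImcB /circle_pt RecMl ImcMl /= sub0r sqrrN.
have -> : 4 * s * sin (theta / 2) ^+ 2 = 2 * s * (1 - cos theta).
  by rewrite (cos_half_angle theta); ring.
have := cos2Dsin2 theta; set x := cos theta; set y := sin theta => xy.
have -> : (1 - s * x) ^+ 2 + (s * y) ^+ 2 = 1 - 2 * s * x + s ^+ 2 * (x ^+ 2 + y ^+ 2).
  by ring.
by rewrite xy; ring.
Qed.

(** By the symmetry [theta -> 2 pi - theta] one may take [theta <= pi]; then
    [sin (theta / 2) >= theta / 8], and [theta >= m pi >= 2 m]. *)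
Lemma sin_half_ge theta m : 0 <= m -> m * pi <= theta -> m * pi <= 2 * pi - theta ->
  m / 4 <= sin (theta / 2).
Proof.
move=> m0 h1 h2; have pi2 := pi_ge2 R; have /andP[_ pi4] := pihalf_02 R.
have H (x : R) : m * pi <= x <= pi -> m / 4 <= sin (x / 2).
  move=> /andP[x1 x2].
  apply: (@le_trans _ _ (x / 2 / 4)); last by apply: sin_ge_linear; nra.
  by nra.
have [tp|tp] := leP theta pi; first by apply: H; rewrite h1 tp.
have -> : sin (theta / 2) = sin ((2 * pi - theta) / 2).
  have -> : (2 * pi - theta) / 2 = - (theta / 2) + pi by field.
  by rewrite sinDpi sinN opprK.
by apply: H; rewrite h2/=; lra.
Qed.

(** Two bounds on the modulus [X] are added: [1 - t <= 1 - t r <= X], and [t m <= 4 X]. The second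
    follows from [X >= 1/2] if [t r <= 1/2], and from the sine term otherwise. Their sum is at most
    [5 X], hence at most [8 X]. *)
Lemma cabs_1Bcircle_ge t r theta m : 0 <= t <= 1 -> 0 <= r < 1 -> 0 <= m <= 1 ->
  m * pi <= theta -> m * pi <= 2 * pi - theta ->
  (1 - t * (1 - m)) / 8 <= cabs (1 - t%:C * circle_pt r theta).
Proof.
move=> /andP[t0 t1] /andP[r0 r1] /andP[m0 m1] h1 h2.
have S := sin_half_ge m0 h1 h2.
rewrite circle_ptM; set s := t * r; set X := cabs _.
have X2 : X ^+ 2 = (1 - s) ^+ 2 + 4 * s * sin (theta / 2) ^+ 2.
  exact: sqr_cabs_1Bcircle.
have s0 : 0 <= s by rewrite mulr_ge0.
have st : s <= t by rewrite /s ler_piMr// ltW.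
have X0 : 0 <= X by exact: cabs_ge0.
have sqr_le (y : R) : 0 <= y -> y ^+ 2 <= X ^+ 2 -> y <= X.
  by move=> y0; rewrite ler_pXn2r ?nnegrE.
have c1 : 1 - s <= X.
  apply: sqr_le; first by lra.
  by rewrite X2 lerDl mulr_ge0 ?sqr_ge0 ?mulr_ge0.
have c2 : t * m <= 4 * X.
  have [s2|s2] := leP s 2^-1.
    by apply: (@le_trans _ _ 1); [exact: mulr_ile1|lra].
  suff : m / 4 <= X by move: m0 t0 t1; clear; nra.
  apply: sqr_le; first by rewrite divr_ge0.
  rewrite X2; have : (m / 4) ^+ 2 <= sin (theta / 2) ^+ 2.
    by rewrite lerXn2r ?nnegrE ?divr_ge0// (le_trans _ S)// divr_ge0.
  have := sqr_ge0 (1 - s); have := sqr_ge0 (sin (theta / 2)).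
  by move: (sin (theta / 2) ^+ 2) ((1 - s) ^+ 2) ((m / 4) ^+ 2) => a b c; nra.
by nra.
Qed.

End CircleDistance.

(** * Comparison of [f] on circles with its radial values *)

Section PointwiseBound.
Context {R : realType}.
Implicit Types (a : nat -> R) (z w : R[i]) (r e : R).

(** The tail at [z] is dominated termwise by the tail at [r]. The right side depends on [r] alone,
    so truncation errors are uniform on [|z| <= r]. *)
Lemma pseries_tail_le a z r N : disc_summable a -> (forall n, 0 <= a n) ->
  cabs z <= r -> r < 1 ->
  cabs ((pseries_disc a z : R[i]) - psum a z N) <=
  cabs (pseries_disc a r%:C) - \sum_(0 <= n < N) a n * r ^+ n.
Proof.
move=> Ha a0 zr r1; have r0 : 0 <= r := le_trans (cabs_ge0 _) zr.
have z1 : cabs z < 1 by exact: le_lt_trans r1.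
apply/ler_addgt0Pr => e e0.
have /cvg_complexP/(_ _ e0)[M _ HM] := psum_cvg Ha z1.
have {HM} /= HM := HM (maxn N M) (leq_maxr _ _).
have NM := leq_maxl N M; set P := maxn N M in HM NM.
have -> : (pseries_disc a z : R[i]) - psum a z N =
    (pseries_disc a z - psum a z P) + ((psum a z P : R[i]) - psum a z N) by ring.
apply: (le_trans (cabsD _ _)); rewrite addrC lerD ?(ltW HM)//.
have -> : (psum a z P : R[i]) - psum a z N = \sum_(N <= n < P) (a n)%:C * z ^+ n.
  by rewrite /psum (big_cat_nat (leq0n N) NM)/= addrAC subrr add0r.
have : \sum_(0 <= n < P) a n * r ^+ n <= cabs (pseries_disc a r%:C).
  by apply: pseries_radial_ge; rewrite ?r0.
rewrite (big_cat_nat (leq0n N) NM)/= -lerBrDl; apply: le_trans.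
have D : \sum_(N <= n < P) (a n)%:C * z ^+ n =
    psum (fun n => if (N <= n)%N then a n else 0) z P :> R[i].
  rewrite /psum [RHS](big_cat_nat (leq0n N) NM)/=.
  rewrite [X in _ = X + _]big_nat [X in _ = X + _]big1 ?add0r; last first.
    by move=> n /andP[_ nN]; rewrite leqNgt nN mul0r.
  by apply: eq_big_nat => n /andP[-> _].
rewrite D; apply: (le_trans (cabs_psum_le _ _ _)).
rewrite [leLHS](big_cat_nat (leq0n N) NM)/=.
rewrite [X in X + _ <= _]big_nat [X in X + _ <= _]big1 ?add0r; last first.
  by move=> n /andP[_ nN]; rewrite leqNgt nN normr0 mul0r.
apply: ler_sum_nat => n /andP[-> _]; rewrite ger0_norm// ler_wpM2l//.
by rewrite lerXn2r ?nnegrE ?cabs_ge0.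
Qed.

Lemma pseries_radial_approx a r e : disc_summable a -> (forall n, 0 <= a n) ->
  0 <= r < 1 -> 0 < e ->
  exists N0, forall N, (N0 <= N)%N ->
    cabs (pseries_disc a r%:C) - \sum_(0 <= n < N) a n * r ^+ n <= e.
Proof.
move=> Ha a0 r01 e0; have /andP[r0 r1] := r01.
have /existsNP[N0 /negP] : ~ (forall N,
    \sum_(0 <= n < N) a n * r ^+ n <= cabs (pseries_disc a r%:C) - e).
  by move=> /(pseries_radial_le Ha a0 r01); lra.
rewrite -ltNge => H; exists N0 => N NN.
rewrite (big_cat_nat (leq0n N0) NN)/=.
have : 0 <= \sum_(N0 <= n < N) a n * r ^+ n.
  by apply: sumr_ge0 => n _; rewrite mulr_ge0 ?exprn_ge0.
by lra.
Qed.

Variable mu : {finite_measure set (measurableTypeR R) -> \bar R}.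
Variables (alpha : R) (c : nat -> R).
Hypotheses (alpha_gt : -1 < alpha) (c0 : c 0%N = 1).
Hypothesis cS : forall n, n.+1%:R * c n.+1 = (n%:R + alpha + 1) * c n.

Let c_ge0 n : 0 <= c n.
Proof. by rewrite ltW// (binomial_coef_gt0 alpha_gt c0 cS). Qed.

Let a n := c n * moment mu n.

Let a_ge0 n : 0 <= a n. Proof. by rewrite mulr_ge0// moment_ge0. Qed.

Lemma disc_summable_frac_moment : disc_summable a.
Proof.
apply: (binomial_disc_summable alpha_gt c0 cS); first exact: moment_ge0.
exact: moment_decreasing.
Qed.

Lemma le_of_powR_inverses (X Y A B s : R) : 0 <= s -> 0 <= X -> 0 <= A -> 0 < B ->
  B / 8 <= A -> X * A `^ s = 1 -> Y * B `^ s = 1 -> X <= 8 `^ s * Y.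
Proof.
move=> s0 X0 A0 B0 H HX HY.
have Bs : 0 < B `^ s by exact: powR_gt0.
have AB : B `^ s <= 8 `^ s * A `^ s.
  rewrite -powRM//; apply: ge0_ler_powR; rewrite ?nnegrE ?(ltW B0)//.
    by rewrite mulr_ge0.
  by move: H; rewrite ler_pdivrMr// mulrC.
rewrite -(ler_pM2r Bs) -mulrA HY mulr1.
apply: (le_trans (ler_wpM2l X0 AB)).
by rewrite mulrCA HX mulr1.
Qed.

Lemma binomial_series_le w (x : R) : cabs w < 1 -> 0 <= x < 1 ->
  (1 - x) / 8 <= cabs (1 - w) ->
  cabs (pseries_disc c w) <= 8 `^ (1 + alpha) * cabs (pseries_disc c x%:C).
Proof.
move=> w1 /andP[x0 x1] H.
have s0 : 0 <= 1 + alpha by have := alpha_gt; lra.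
have x1' : cabs x%:C < 1 by rewrite cabs_real ger0_norm.
have E : cabs (1 - x%:C) = 1 - x.
  rewrite -[1 - x%:C](rmorphB (real_complex R) 1 x) cabs_real ger0_norm//.
  by rewrite subr_ge0 ltW.
apply: (le_of_powR_inverses s0 (cabs_ge0 _) (cabs_ge0 (1 - w)) _ H).
- by rewrite subr_gt0.
- exact: cabs_binomial_series.
- by rewrite -E; exact: cabs_binomial_series.
Qed.

(** Arithmetic of a chain with two truncation errors, one of which is multiplied by [K]: together
    they cost [(K + 1) e]. *)
Lemma le_chain_slack (x1 x2 x3 x4 y K e : R) : 0 <= K -> x1 <= x2 ->
  x2 <= x3 + e -> x3 <= K * x4 -> x4 <= y + e -> 0 <= (K + 1) * e + (K * y - x1).
Proof. by move=> K0 h1 h2 h3 /(ler_wpM2l K0); lra. Qed.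

(* f(z) is the integral of G(t z) against mu, so |G(t w)| <= C G(t r) passes from G
   to f. Only partial sums of G are integrated, with an error uniform in t. *)
Lemma frac_moment_series_le w r : cabs w < 1 -> 0 <= r < 1 ->
  (forall t, 0 <= t < 1 -> (1 - t * r) / 8 <= cabs (1 - t%:C * w)) ->
  cabs (pseries_disc a w) <= 8 `^ (1 + alpha) * cabs (pseries_disc a r%:C).
Proof.
move=> w1 r01 H; have /andP[r0 r1] := r01.
have Hc := binomial_summable alpha_gt c0 cS; have Ha := disc_summable_frac_moment.
set K := 8 `^ (1 + alpha); have K0 : 0 <= K by exact: powR_ge0.
have w01 : 0 <= cabs w < 1 by rewrite cabs_ge0.
have mu0 := moment_ge0 mu 0.
suff Heps e : 0 < e -> cabs (pseries_disc a w) <=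
    K * cabs (pseries_disc a r%:C) + e * (1 + (K + 1) * moment mu 0).
  apply/ler_addgt0Pr => e e0.
  have d0 : 0 < 1 + (K + 1) * moment mu 0.
    by rewrite ltr_wpDr// mulr_ge0// addr_ge0.
  by have := Heps _ (divr_gt0 e0 d0); rewrite divfK// gt_eqF.
move=> e0.
have [N1 HN1] := pseries_radial_approx Hc c_ge0 r01 e0.
have [N2 HN2] := pseries_radial_approx Hc c_ge0 w01 e0.
have [N3 HN3] := pseries_radial_approx Ha a_ge0 w01 e0.
pose N := maxn N1 (maxn N2 N3).
have {}HN1 := HN1 N (leq_maxl _ _).
have {}HN2 := HN2 N (leq_trans (leq_maxl _ _) (leq_maxr _ _)).
have {}HN3 := HN3 N (leq_trans (leq_maxr _ _) (leq_maxr _ _)).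
have T3 := le_trans (pseries_tail_le N Ha a_ge0 (lexx _) w1) HN3.
pose S : R[i] := psum a w N.
suff HS : cabs S <= K * cabs (pseries_disc a r%:C) + (K + 1) * e * moment mu 0.
  apply: (le_trans (cabs_subD _ S)); apply: (le_trans (lerD T3 HS)).
  by rewrite le_eqVlt; apply/orP; left; apply/eqP; ring.
have RHS0 : 0 <= K * cabs (pseries_disc a r%:C) + (K + 1) * e * moment mu 0.
  by rewrite addr_ge0 ?mulr_ge0 ?addr_ge0 ?cabs_ge0// ltW.
have [S0|S0] := eqVneq S 0; first by rewrite S0 cabs0.
(* A unimodular factor that turns |S| into a real linear functional of S. *)
pose u : R[i] := S^-1 * (cabs S)%:C.
have cS0 : cabs S != 0.
  by apply: contra_neq S0 => /ComplexField.Normc.eq0_normc.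
have u1 : cabs u = 1.
  rewrite /u cabsM cabs_real ger0_norm ?cabs_ge0//.
  have -> : cabs S^-1 = (cabs S)^-1 by exact: ComplexField.Normc.normcV.
  by rewrite mulVf.
have uS : cabs S = \sum_(0 <= n < N) c n * complex.Re (u * w ^+ n) * moment mu n.
  have -> : cabs S = complex.Re (u * S) by rewrite /u mulrAC mulVf// mul1r.
  rewrite /S /psum; elim: (N) => [|M IH]; first by rewrite !big_geq// mulr0.
  rewrite !big_nat_recr//= mulrDr RecD IH; congr (_ + _).
  by rewrite mulrCA RecMl mulrAC /a; ring.
(* As a polynomial in [t], [sum k_n t^n] is [K] times a partial sum of [G(t r)] minus the real part
   of [u] times a partial sum of [G(t w)]; it is at least [- (K + 1) e] on [[0, 1)]. *)
pose k n := K * (c n * r ^+ n) - c n * complex.Re (u * w ^+ n).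
have kE (x : nat -> R) : \sum_(0 <= n < N) k n * x n =
    K * (\sum_(0 <= n < N) c n * x n * r ^+ n) -
    \sum_(0 <= n < N) c n * complex.Re (u * w ^+ n) * x n.
  by rewrite mulr_sumr -sumrB; apply: eq_bigr => n _; rewrite /k; ring.
have := @moment_poly_ge0 _ mu ((K + 1) * e) k N.
rewrite kE -uS => /(_ _) P.
have {}P : cabs S <= K * (\sum_(0 <= n < N) c n * moment mu n * r ^+ n) +
    (K + 1) * e * moment mu 0.
  rewrite -subr_ge0; have -> : K * (\sum_(0 <= n < N) c n * moment mu n * r ^+ n) +
    (K + 1) * e * moment mu 0 - cabs S = (K + 1) * e * moment mu 0 +
    (K * (\sum_(0 <= n < N) c n * moment mu n * r ^+ n) - cabs S) by ring.
  apply: P => t t01; have /andP[t0 t1] := t01.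
  rewrite (kE (fun n => t ^+ n)).
  have -> : \sum_(0 <= n < N) c n * complex.Re (u * w ^+ n) * t ^+ n =
      complex.Re (u * psum c (t%:C * w) N).
    rewrite /psum; elim: (N) => [|M IH]; first by rewrite !big_geq// mulr0.
    rewrite !big_nat_recr//= mulrDr RecD IH; congr (_ + _).
    rewrite exprMn -rmorphXn mulrCA RecMl [u * (_ * _)]mulrCA RecMl.
    by ring.
  have tw1 : cabs (t%:C * w) <= cabs w.
    by rewrite cabsM cabs_real ger0_norm// ler_piMl ?cabs_ge0// ltW.
  have trr : t * r <= r by rewrite ler_piMl// ltW.
  have tr0 : 0 <= t * r by rewrite mulr_ge0.
  have B1 : complex.Re (u * psum c (t%:C * w) N) <= cabs (psum c (t%:C * w) N).
    apply: (le_trans (le_trans (ler_norm _) (Re_le_cabs _))).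
    by rewrite cabsM u1 mul1r.
  have B2 : cabs (psum c (t%:C * w) N) <= cabs (pseries_disc c (t%:C * w)) + e.
    have := le_trans (pseries_tail_le N Hc c_ge0 tw1 w1) HN2.
    rewrite -cabsN opprB => T.
    by apply: (le_trans (cabs_subD _ (pseries_disc c (t%:C * w)))); rewrite addrC lerD2l.
  have B3 : cabs (pseries_disc c (t%:C * w)) <= K * cabs (pseries_disc c (t * r)%:C).
    apply: binomial_series_le; first exact: le_lt_trans w1.
      by rewrite tr0; exact: le_lt_trans r1.
    exact: H.
  have B4 : cabs (pseries_disc c (t * r)%:C) <=
      \sum_(0 <= n < N) c n * t ^+ n * r ^+ n + e.
    have trC : cabs (t * r)%:C <= r by rewrite cabs_real ger0_norm.
    have T := le_trans (pseries_tail_le N Hc c_ge0 trC r1) HN1.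
    apply: (le_trans (cabs_subD _ (psum c (t * r)%:C N))); rewrite addrC lerD//.
    rewrite psum_real cabs_real ger0_norm.
      by apply: ler_sum_nat => n _; rewrite exprMn mulrA.
    by apply: sumr_ge0 => n _; rewrite mulr_ge0 ?exprn_ge0.
  exact: (le_chain_slack K0 B1 B2 B3 B4).
apply: (le_trans P); rewrite lerD2r ler_wpM2l//.
exact: pseries_radial_ge.
Qed.

(** The bound does not involve [r]: away from argument 0, [f] is controlled by its value at [1 - m],
    however close [r] is to 1. *)
Lemma frac_moment_circle_le (r theta m : R) : 0 <= r < 1 -> 0 < m <= 1 ->
  m * pi <= theta -> m * pi <= 2 * pi - theta ->
  cabs (pseries_disc a (circle_pt r theta)) <=
  8 `^ (1 + alpha) * cabs (pseries_disc a (1 - m)%:C).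
Proof.
move=> r01 /andP[m0 m1] h1 h2; have /andP[r0 r1] := r01.
apply: frac_moment_series_le.
- by rewrite cabs_circle_pt ger0_norm.
- by apply/andP; split; lra.
- move=> t /andP[t0 t1]; apply: cabs_1Bcircle_ge => //.
  + by rewrite t0 ltW.
  + by rewrite m1 ltW.
Qed.

Lemma frac_moment_circle_ge (r theta : R) : 0 <= r < 1 ->
  theta ^+ 2 * ((3 + alpha) * (1 + alpha)) <= (1 - r) ^+ 2 ->
  2^-1 * cabs (pseries_disc a r%:C) <= cabs (pseries_disc a (circle_pt r theta)).
Proof.
move=> r01 Ht; have /andP[r0 r1] := r01; have Ha := disc_summable_frac_moment.
apply: le_trans (le_trans (ler_norm _) (Re_le_cabs _)).
apply/ler_addgt0Pr => e e0.
have e20 : 0 < 2 * e by rewrite mulr_gt0.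
have [N HN] := pseries_radial_approx Ha a_ge0 r01 e20.
have w1 : cabs (circle_pt r theta) < 1 by rewrite cabs_circle_pt ger0_norm.
rewrite -lerBlDr; apply: (cvg_Re_ge (psum_cvg Ha w1)).
exists N => // M /= NM; rewrite Re_psum.
apply: (@le_trans _ _ (2^-1 * \sum_(0 <= n < M) a n * r ^+ n)).
  by have := HN _ NM; lra.
apply: (le_trans (cos_psum_ge alpha_gt c0 cS (moment_ge0 mu)
  (@moment_decreasing _ mu) M r01 Ht)).
rewrite le_eqVlt; apply/orP; left; apply/eqP; apply: eq_bigr => n _.
by rewrite circle_ptX RecMl/= mulrA.
Qed.

End PointwiseBound.

(** * Integral means *)

Section DyadicIntegral.
Context {R : realType}.
Implicit Types (u b B : nat -> R).
Notation mu := (@lebesgue_measure R).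

Lemma nneseries_lty_bounded u : (forall n, 0 <= u n) ->
  (\sum_(0 <= n <oo) (u n)%:E < +oo)%E <-> bounded_psums u.
Proof.
move=> u0; split=> [H|[M HM]].
  have fin : (\sum_(0 <= n <oo) (u n)%:E)%E \is a fin_num.
    by rewrite ge0_fin_numE// nneseries_ge0// => n _ _; rewrite lee_fin.
  exists (fine (\sum_(0 <= n <oo) (u n)%:E)%E) => N.
  rewrite -lee_fin fineK// -sumEFin; apply: nneseries_lim_ge => n _ _.
  by rewrite lee_fin.
apply: (@le_lt_trans _ _ M%:E); last exact: ltry.
apply: lime_le; first by apply: is_cvg_nneseries => n _ _; rewrite lee_fin.
by apply: nearW => N; rewrite sumEFin lee_fin.
Qed.

Definition dyadic_shell n : set R := `]1 - 2^-1 ^+ n, 1 - 2^-1 ^+ n.+1]%classic.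

Let half_exp_gt0 n : 0 < 2^-1 ^+ n :> R.
Proof. by rewrite exprn_gt0// invr_gt0. Qed.

Let half_exp_le m n : (m <= n)%N -> 2^-1 ^+ n <= 2^-1 ^+ m :> R.
Proof. by move=> mn; apply: ler_wiXn2l => //; rewrite invf_le1// ler1n. Qed.

Lemma trivIset_dyadic_shell : trivIset setT dyadic_shell.
Proof.
have H m n x : (m < n)%N -> dyadic_shell m x -> dyadic_shell n x -> False.
  rewrite /dyadic_shell/= !in_itv/= => mn /andP[_ h1] /andP[h2 _].
  by have := half_exp_le mn; lra.
move=> m n _ _ [x [xm xn]].
by have [/H/(_ xm xn)|/H/(_ xn xm)|] := ltngtP m n.
Qed.

Lemma bigcup_dyadic_shell : \bigcup_n dyadic_shell n = `](0 : R), 1[%classic.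
Proof.
apply/seteqP; split=> x.
  move=> [n _]; rewrite /dyadic_shell/= !in_itv/= => /andP[h1 h2].
  have := half_exp_gt0 n.+1; have := half_exp_le (leq0n n); rewrite expr0.
  by move=> ? ?; apply/andP; split; lra.
rewrite /= in_itv/= => /andP[x0 x1].
have ex : exists n, 2^-1 ^+ n.+1 <= 1 - x.
  exists (Num.truncn (1 - x)^-1).
  rewrite exprVn -[leRHS]invrK lef_pV2 ?posrE ?exprn_gt0 ?invr_gt0 ?subr_gt0//.
  apply: (le_trans (ltW (truncnS_gt _))).
  by rewrite -natrX ler_nat ltnW// ltn_expl.
case: (ex_minnP ex) => n hn nmin; exists n => //.
rewrite /dyadic_shell/= in_itv/=; apply/andP; split; last by lra.
case: n nmin hn => [|n] nmin hn; first by rewrite expr0; lra.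
rewrite ltNge; apply/negP => h.
have : (n.+1 <= n)%N by apply: nmin; lra.
by rewrite ltnn.
Qed.

(** Index of the shell containing [x]. Only the step functions [b (idx x)] have to be measurable,
    not the functions compared with them. *)
Let idx (x : R) : nat := xget 0%N [set n | dyadic_shell n x].

Let idxE n x : dyadic_shell n x -> idx x = n.
Proof.
move=> nx; have : dyadic_shell (idx x) x.
  by apply: (@xgetPex _ 0%N [set n | dyadic_shell n x]); exists n.
move=> ix; apply: (trivIset_dyadic_shell (i := idx x) (j := n)) => //.
by exists x.
Qed.

Let measurable_shell n : measurable (dyadic_shell n : set (measurableTypeR R)).
Proof. exact: measurable_itv. Qed.

Let lebesgue_dyadic_shell n : mu (dyadic_shell n) = (2^-1 ^+ n.+1)%:E.
Proof.
apply: (etrans (lebesgue_measure_itv _)); rewrite /= lte_fin.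
rewrite ifT; last by have := half_exp_gt0 n; rewrite exprS; lra.
by rewrite -EFinB; congr _%:E; rewrite !exprS; lra.
Qed.

Let integral_step b : (forall n, 0 <= b n) ->
  (\int[mu]_(x in `]0%R, 1%R[) (b (idx x))%:E =
   \sum_(0 <= n <oo) (b n * 2^-1 ^+ n.+1)%:E)%E.
Proof.
move=> b0; rewrite -bigcup_dyadic_shell ge0_integral_bigcup//.
- apply: eq_eseriesr => n _.
  transitivity (\int[mu]_(x in dyadic_shell n) (cst (b n)%:E x))%E.
    by apply: eq_integral => x; rewrite inE => /idxE ->.
  rewrite (integral_cst _ (measurable_shell n)) [RHS]EFinM; congr (_ * _)%E.
  exact: lebesgue_dyadic_shell.
- apply/measurable_fun_bigcup => // n.
  apply: (eq_measurable_fun (cst (b n)%:E)); last exact: measurable_cst.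
  by move=> x; rewrite inE => /idxE ->.
- by move=> x _; rewrite lee_fin.
- exact: trivIset_dyadic_shell.
Qed.

Lemma integral_dyadic_le (phi : R -> \bar R) b : (forall n, 0 <= b n) ->
  (forall x, (0 <= phi x)%E) ->
  (forall n x, dyadic_shell n x -> (phi x <= (b n)%:E)%E) ->
  (\int[mu]_(x in `]0%R, 1%R[) phi x <= \sum_(0 <= n <oo) (b n * 2^-1 ^+ n.+1)%:E)%E.
Proof.
move=> b0 p0 H; rewrite -integral_step//; apply: ge0_integral_le => // x.
by rewrite -bigcup_dyadic_shell => -[n _ nx]; rewrite (idxE nx); exact: H.
Qed.

Lemma integral_dyadic_ge (phi : R -> \bar R) b : (forall n, 0 <= b n) ->
  (forall n x, dyadic_shell n x -> ((b n)%:E <= phi x)%E) ->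
  (\sum_(0 <= n <oo) (b n * 2^-1 ^+ n.+1)%:E <= \int[mu]_(x in `]0%R, 1%R[) phi x)%E.
Proof.
move=> b0 H; rewrite -integral_step//; apply: ge0_integral_le => [x _|x].
  by rewrite lee_fin.
by rewrite -bigcup_dyadic_shell => -[n _ nx]; rewrite (idxE nx); exact: H.
Qed.

Lemma dyadic_shell_weight n x (e : R) : dyadic_shell n x ->
  2 `^ (- `|e|) * (2 `^ (- e)) ^+ n <= (1 - x) `^ e <= 2 `^ `|e| * (2 `^ (- e)) ^+ n.
Proof.
rewrite /dyadic_shell/= in_itv/= => /andP[x1 x2].
have hn := half_exp_gt0 n.
have y0 : 0 < 1 - x by have := half_exp_gt0 n.+1; lra.
have E : (2^-1 ^+ n : R) `^ e = (2 `^ (- e)) ^+ n.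
  rewrite powR_exprAC ?invr_ge0//; congr (_ ^+ _).
  by rewrite -powR_inv1// -powRrM mulN1r.
have -> : 1 - x = (1 - x) / 2^-1 ^+ n * 2^-1 ^+ n by rewrite mulfVK ?gt_eqF.
rewrite powRM ?divr_ge0 ?(ltW y0) ?(ltW hn)// E.
rewrite !ler_pM2r ?exprn_gt0 ?powR_gt0//; apply: powR_half_two.
rewrite ler_pdivlMr// ler_pdivrMr//; rewrite exprS in x2.
by apply/andP; split; lra.
Qed.

(** On shell [n] the weight is comparable to [2 ^ (- n (g q - 1))] and the length is
    [2 ^ - (n + 1)]; the length cancels the [- 1] in the exponent of the weight. *)
Lemma weighted_integral_lty (psi : R -> \bar R) B (g q : R) :
  (forall n, 0 <= B n) -> (forall x, (0 <= psi x)%E) ->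
  (forall n x, dyadic_shell n x -> (psi x <= (B n)%:E)%E) ->
  bounded_psums (fun n => (2 `^ (- g * q)) ^+ n * B n) ->
  (\int[mu]_(x in `]0%R, 1%R[) (((1 - x) `^ (g * q - 1))%:E * psi x) < +oo)%E.
Proof.
move=> B0 psi0 H HB; set e := g * q - 1.
pose b n := 2 `^ `|e| * (2 `^ (- e)) ^+ n * B n.
have b0 n : 0 <= b n by rewrite !mulr_ge0 ?exprn_ge0 ?powR_ge0.
apply: le_lt_trans (integral_dyadic_le b0 _ _) _.
- by move=> x; rewrite mule_ge0// lee_fin powR_ge0.
- move=> n x nx; have /andP[_ w] := dyadic_shell_weight e nx.
  by rewrite /b EFinM lee_pmul// ?lee_fin ?powR_ge0//; exact: H.
- apply/nneseries_lty_bounded; first by move=> n; rewrite mulr_ge0// exprn_ge0 ?invr_ge0.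
  apply: le_bounded_psums (_ : 0 <= 2 `^ `|e|) _ HB; first exact: powR_ge0.
  move=> n; rewrite /b -!mulrA ler_wpM2l ?powR_ge0// mulrCA [leRHS]mulrC.
  rewrite ler_wpM2l//.
  have -> : 2 `^ (- g * q) = 2 `^ (- e) * 2^-1.
    rewrite -[X in _ = _ * X]powR_inv1// -powRD ?pnatr_eq0 ?implybT//.
    by congr (_ `^ _); rewrite /e; ring.
  rewrite exprMn ler_wpM2l ?exprn_ge0 ?powR_ge0//.
  exact: half_exp_le.
Qed.

Lemma weighted_integral_bounded (psi : R -> \bar R) B (g q : R) :
  (forall n, 0 <= B n) ->
  (forall n x, dyadic_shell n x -> ((B n)%:E <= psi x)%E) ->
  (\int[mu]_(x in `]0%R, 1%R[) (((1 - x) `^ (g * q - 1))%:E * psi x) < +oo)%E ->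
  bounded_psums (fun n => (2 `^ (- g * q)) ^+ n * B n).
Proof.
move=> B0 H; set e := g * q - 1.
pose b n := 2 `^ (- `|e|) * (2 `^ (- e)) ^+ n * B n.
have b0 n : 0 <= b n by rewrite !mulr_ge0 ?exprn_ge0 ?powR_ge0.
move=> /(le_lt_trans (integral_dyadic_ge b0 _)) HI.
have {HI} : bounded_psums (fun n => b n * 2^-1 ^+ n.+1).
  apply/nneseries_lty_bounded; first by move=> n; rewrite mulr_ge0// exprn_ge0 ?invr_ge0.
  apply: HI => n x nx; have /andP[w _] := dyadic_shell_weight e nx.
  by rewrite /b EFinM lee_pmul ?lee_fin ?mulr_ge0 ?exprn_ge0 ?powR_ge0//; exact: H.
have C0 : 0 < 2 `^ (- `|e|) * 2^-1 :> R by rewrite mulr_gt0 ?powR_gt0 ?invr_gt0.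
apply: (@le_bounded_psums _ _ _ (2 `^ (- `|e|) * 2^-1)^-1).
  by rewrite invr_ge0 ltW.
move=> n; rewrite ler_pdivlMl//.
have -> : 2 `^ (- g * q) = 2 `^ (- e) * 2^-1.
  rewrite -[X in _ = _ * X]powR_inv1// -powRD ?pnatr_eq0 ?implybT//.
  by congr (_ `^ _); rewrite /e; ring.
by rewrite /b exprMn exprS le_eqVlt; apply/orP; left; apply/eqP; ring.
Qed.

End DyadicIntegral.

(** * Integral means and dyadic arcs *)

Section CircleMeans.
Context {R : realType}.
Implicit Types (g : R -> R) (v : nat -> R).

(** The [p]-th power of the integral mean; leaving out the root keeps it additive over arcs. *)
Definition circle_mean (p : R) g : \bar R :=
  (\int[lebesgue_measure]_(theta in `[0%R, (2 * pi)%R]) (g theta `^ p / (2 * pi))%:E)%E.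

Let pi2_gt0 : 0 < 2 * pi :> R. Proof. by rewrite mulr_gt0// pi_gt0. Qed.

Lemma circle_mean_ge g (p d w : R) : 0 < p -> 0 <= w -> 0 < d <= 1 ->
  (forall theta, 0 <= theta <= d -> w <= g theta) ->
  ((d * (w `^ p / (2 * pi)))%:E <= circle_mean p g)%E.
Proof.
move=> p0 w0 /andP[d0 d1] H.
have c0 : 0 <= w `^ p / (2 * pi) by rewrite divr_ge0 ?powR_ge0// ltW.
apply: (@le_trans _ _ (\int[lebesgue_measure]_(x in `[0%R, d])
    (cst (w `^ p / (2 * pi))%:E x))%E).
  rewrite integral_cst//= lebesgue_measure_itv/= lte_fin d0 -EFinB -EFinM.
  by rewrite lee_fin subr0 mulrC.
rewrite /circle_mean integral_mkcond [leRHS]integral_mkcond.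
apply: ge0_integral_le => x _; first by apply: erestrict_ge0 => y _; rewrite lee_fin.
rewrite !patchE; case: ifPn => [|_]; last first.
  by case: ifPn => // _; rewrite lee_fin divr_ge0 ?powR_ge0// ltW.
rewrite inE/= in_itv/= => /andP[x0 xd].
rewrite ifT; last by rewrite inE/= in_itv/= x0/=; have := pi_ge2 R; lra.
have wg : w <= g x by apply: H; rewrite x0.
rewrite lee_fin ler_pM2r ?invr_gt0//.
by apply: ge0_ler_powR; rewrite ?nnegrE ?(ltW p0)// (le_trans w0).
Qed.

Let arc_left k : set R := `[0, pi * 2^-1 ^+ k]%classic.
Let arc_right k : set R := `[2 * pi - pi * 2^-1 ^+ k, 2 * pi]%classic.

Let arc_len_bounds k : 0 < (pi : R) * 2^-1 ^+ k <= pi.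
Proof.
rewrite mulr_gt0 ?pi_gt0 ?exprn_gt0 ?invr_gt0//=.
by rewrite ler_piMr ?pi_ge0// exprn_ile1 ?invr_ge0// invf_le1// ler1n.
Qed.

Let lebesgue_arc_left k : lebesgue_measure (arc_left k) = (pi * 2^-1 ^+ k)%:E :> \bar R.
Proof.
have /andP[h _] := arc_len_bounds k.
by apply: (etrans (lebesgue_measure_itv _)); rewrite /= lte_fin h -EFinB subr0.
Qed.

Let lebesgue_arc_right k : lebesgue_measure (arc_right k) = (pi * 2^-1 ^+ k)%:E :> \bar R.
Proof.
have /andP[h _] := arc_len_bounds k.
apply: (etrans (lebesgue_measure_itv _)); rewrite /= lte_fin ifT; last by lra.
by rewrite -EFinB; congr _%:E; ring.
Qed.

(** The arcs are nested rather than disjoint: at each point some term [k] of the majorant dominates,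
    and the others are nonnegative. The two arcs of index [k] have total length [2 pi 2^-k], which
    cancels the normalisation [1 / (2 pi)]. *)
Lemma circle_mean_le g (p : R) v N : 0 < p -> (forall n, 0 <= v n) ->
  (forall theta, 0 <= g theta) ->
  (forall theta, 0 <= theta <= 2 * pi -> exists k, [/\ (k < N)%N, g theta <= v k &
     (theta <= pi * 2^-1 ^+ k) || (2 * pi - theta <= pi * 2^-1 ^+ k)]) ->
  (circle_mean p g <= (\sum_(0 <= k < N) 2^-1 ^+ k * v k `^ p)%:E)%E.
Proof.
move=> p0 v0 g0 H.
pose D : set (measurableTypeR R) := `[0, 2 * pi]%classic.
have mD : measurable D by exact: measurable_itv.
pose w k := v k `^ p / (2 * pi).
have w0 k : 0 <= w k by rewrite divr_ge0 ?powR_ge0// ltW.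
have mL k : measurable (arc_left k : set (measurableTypeR R)) by exact: measurable_itv.
have mR k : measurable (arc_right k : set (measurableTypeR R)) by exact: measurable_itv.
pose h k (x : measurableTypeR R) : \bar R :=
  ((w k)%:E * ((\1_(arc_left k) x)%:E + (\1_(arc_right k) x)%:E))%E.
have h0 k x : (0 <= h k x)%E by rewrite mule_ge0// ?lee_fin// adde_ge0// lee_fin.
have mI (A : set (measurableTypeR R)) : measurable A ->
    measurable_fun D (fun x => (\1_A x)%:E : \bar R).
  by move=> mA; apply/measurable_EFinP; exact: measurable_indic.
have mh k : measurable_fun D (h k).
  by apply: measurable_funeM; apply: emeasurable_funD; exact: mI.
have Ih k : (\int[lebesgue_measure]_(x in D) h k x <= (2^-1 ^+ k * v k `^ p)%:E)%E.
  rewrite /h ge0_integralZl//; last 3 first.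
  - by apply: emeasurable_funD; exact: mI.
  - by move=> x _; rewrite adde_ge0// lee_fin.
  - by rewrite lee_fin.
  rewrite ge0_integralD//; try by [move=> x _; rewrite lee_fin|exact: mI].
  rewrite !integral_indic//.
  apply: (@le_trans _ _ ((w k)%:E *
     (lebesgue_measure (arc_left k) + lebesgue_measure (arc_right k)))%E).
    rewrite lee_wpmul2l ?lee_fin// leeD// le_measure ?inE//; exact: measurableI.
  rewrite lebesgue_arc_left lebesgue_arc_right -EFinD -EFinM lee_fin /w.
  rewrite le_eqVlt; apply/orP; left; apply/eqP.
  have := lt0r_neq0 (pi_gt0 R); move: (pi) => P P0; field.
  exact: P0.
apply: (@le_trans _ _ (\int[lebesgue_measure]_(x in D) \sum_(0 <= k < N) h k x)%E).
  apply: ge0_integral_le => x.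
    by move=> _; rewrite lee_fin divr_ge0 ?powR_ge0// ltW.
  rewrite /D/= in_itv/= => /andP[x0 x1].
  have [|k [kN gk arck]] := H x; first by rewrite x0.
  apply: (@le_trans _ _ (h k x)); last first.
    rewrite big_mkord (bigD1 (Ordinal kN))//= leeDl// sume_ge0//.
  apply: (@le_trans _ _ (w k)%:E).
    rewrite lee_fin /w ler_pM2r ?invr_gt0//.
    by apply: ge0_ler_powR; rewrite ?nnegrE ?(ltW p0).
  rewrite /h -EFinD -EFinM lee_fin ler_peMr// !indicE.
  case/orP: arck => arck.
    rewrite (_ : x \in arc_left k) ?lerDl//.
    by rewrite inE /arc_left/= in_itv/= x0.
  rewrite (_ : x \in arc_right k) ?lerDr//.
  by rewrite inE /arc_right/= in_itv/= x1 andbT; lra.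
rewrite ge0_integral_sum//.
rewrite -sumEFin; apply: lee_sum => k _; exact: Ih.
Qed.

Lemma M_fin_ge (f : R[i]^o -> R[i]^o) (p q r x : R) : 0 < p -> 0 < q -> 0 <= x ->
  (x%:E <= circle_mean p (fun theta => cabs (f (circle_pt r theta))))%E ->
  ((x `^ (q / p))%:E <= M_ p%:E f r `^ q)%E.
Proof.
move=> p0 q0 x0 H; rewrite /M_ -poweRrM -poweR_EFin [q / p]mulrC.
have qp0 : 0 <= p^-1 * q by rewrite mulr_ge0 ?invr_ge0 ?ltW.
apply: (gt0_ler_poweR qp0) => //; rewrite in_itv/= leey andbT.
  by rewrite lee_fin.
by apply: le_trans H; rewrite lee_fin.
Qed.

Lemma M_fin_le (f : R[i]^o -> R[i]^o) (p q r x : R) : 0 < p -> 0 < q -> 0 <= x ->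
  (circle_mean p (fun theta => cabs (f (circle_pt r theta))) <= x%:E)%E ->
  (M_ p%:E f r `^ q <= (x `^ (q / p))%:E)%E.
Proof.
move=> p0 q0 x0 H; rewrite /M_ -poweRrM -poweR_EFin [q / p]mulrC.
have qp0 : 0 <= p^-1 * q by rewrite mulr_ge0 ?invr_ge0 ?ltW.
apply: (gt0_ler_poweR qp0) => //; rewrite in_itv/= leey andbT.
  by apply: integral_ge0 => y _; rewrite lee_fin divr_ge0 ?powR_ge0// ltW.
by rewrite lee_fin.
Qed.

End CircleMeans.

Definition dyadic_radius (R : realType) n : R := 1 - 2^-1 ^+ n.

Section DyadicRadius.
Context {R : realType}.
Notation rad := (@dyadic_radius R).

Lemma half_exp_bounds n : 0 < (2^-1 : R) ^+ n <= 1.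
Proof. by rewrite exprn_gt0 ?invr_gt0//= exprn_ile1 ?invr_ge0// invf_le1// ler1n. Qed.

Lemma dyadic_radius_bounds n : 0 <= rad n < 1.
Proof.
by have := half_exp_bounds n; rewrite /dyadic_radius => /andP[? ?]; apply/andP; split; lra.
Qed.

Lemma dyadic_shell_bounds n r : dyadic_shell n r -> [/\ rad n <= r, r <= rad n.+1, 0 <= r & r < 1].
Proof.
rewrite /dyadic_shell/= in_itv/= => /andP[h1 h2].
have /andP[k1 k2] := dyadic_radius_bounds n; have /andP[k3 k4] := dyadic_radius_bounds n.+1.
by rewrite /dyadic_radius in k1 k2 k3 k4 *; split; lra.
Qed.

Lemma geometric_shift (l : R) (u : nat -> R) : 0 < l ->
  bounded_psums (fun n => l ^+ n * u n) -> bounded_psums (fun n => l ^+ n * u n.+1).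
Proof.
move=> l0 H; have := (bounded_psums_shift _).2 H.
apply: (@le_bounded_psums _ _ _ l^-1); first by rewrite invr_ge0 ltW.
by move=> n; rewrite exprS -mulrA mulKf// gt_eqF.
Qed.

End DyadicRadius.

Lemma arc_constant_le (R : realType) (d P x y p : R) n : 0 <= d -> 0 < P -> 0 <= y ->
  x <= y `^ p ->
  d / 2 * (2^-1 `^ p / (2 * P)) * (2^-1 ^+ n * x) <=
  d * 2^-1 ^+ n.+1 * ((2^-1 * y) `^ p / (2 * P)).
Proof.
move=> d0 P0 y0 xy; rewrite powRM ?invr_ge0//.
have -> : d * 2^-1 ^+ n.+1 * (2^-1 `^ p * y `^ p / (2 * P)) =
   d / 2 * (2^-1 `^ p / (2 * P)) * (2^-1 ^+ n * y `^ p) by rewrite exprS; ring.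
rewrite ler_wpM2l//; last by rewrite ler_wpM2l// exprn_ge0 ?invr_ge0.
by rewrite mulr_ge0 ?divr_ge0 ?powR_ge0 ?mulr_ge0 ?(ltW P0).
Qed.

(** * From integral means to dyadic sums of a radial majorant *)

Section HSpaceMeans.
Context {R : realType}.
Variables (f : R[i]^o -> R[i]^o) (F : R -> R).
Notation rad := (@dyadic_radius R).
Hypothesis f_analytic : analytic_on_disc f.
Hypothesis F_ge0 : forall r, 0 <= F r.
Hypothesis F_mono : forall r s, 0 <= r -> r <= s -> s < 1 -> F r <= F s.

Lemma H_space_infty_psums (g q : R) : 0 < q ->
  (forall r, 0 <= r < 1 -> M_ +oo%E f r = (F r)%:E) ->
  H_space +oo%E q g f <-> bounded_psums (fun n => (2 `^ (- g * q)) ^+ n * F (rad n) `^ q).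
Proof.
move=> q0 M_infty; split=> [[_ H]|H].
  apply: weighted_integral_bounded H; first by move=> n; exact: powR_ge0.
  move=> n r /dyadic_shell_bounds[h1 h2 r0 r1]; rewrite M_infty ?r0// poweR_EFin lee_fin.
  apply: ge0_ler_powR; rewrite ?nnegrE ?(ltW q0) ?F_ge0//; apply: F_mono => //.
  by case/andP: (@dyadic_radius_bounds R n).
split; first exact: f_analytic.
apply: (@weighted_integral_lty _ _ (fun n => F (rad n.+1) `^ q)).
- by move=> n; exact: powR_ge0.
- by move=> r; exact: poweR_ge0.
- move=> n r /dyadic_shell_bounds[h1 h2 r0 r1]; rewrite M_infty ?r0// poweR_EFin lee_fin.
  apply: ge0_ler_powR; rewrite ?nnegrE ?(ltW q0) ?F_ge0//; apply: F_mono => //.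
  by case/andP: (@dyadic_radius_bounds R n.+1).
- by apply: (geometric_shift (u := fun n => F (rad n) `^ q)) => //; exact: powR_gt0.
Qed.

(** An arc of length [2^-n] contributes [(2^-n F^p)^(q/p) = 2^(-n q/p) F^q], which shifts [g] by
    [1/p]. In the upper bound, Hardy's inequality with exponent [q / p] and ratio [2 ^ (- g q) < 1]
    replaces the sum over arcs by its individual terms. *)
Lemma H_space_fin_psums (p g q : R) : 0 < p -> 0 < q -> 0 < g ->
  (exists2 K, 0 < K & forall n r, dyadic_shell n r ->
    ((K * (2^-1 ^+ n * F (rad n) `^ p))%:E <=
     circle_mean p (fun theta => cabs (f (circle_pt r theta))))%E) ->
  (exists2 K, 0 < K & forall n r, dyadic_shell n r ->
    (circle_mean p (fun theta => cabs (f (circle_pt r theta))) <=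
     (K * \sum_(0 <= k < n.+2) 2^-1 ^+ k * F (rad k.+1) `^ p)%:E)%E) ->
  H_space p%:E q g f <->
  bounded_psums (fun n => (2 `^ (- (g + p^-1) * q)) ^+ n * F (rad n) `^ q).
Proof.
move=> p0 q0 g0 circle_mean_lower circle_mean_upper; set l := 2 `^ (- g * q).
have qp0 : 0 < q / p by rewrite divr_gt0.
have l0 : 0 < l by exact: powR_gt0.
have l1 : l < 1.
  rewrite /l mulNr -[ltRHS](powRr0 2) /powR gt_eqF// ltr_expR mul0r mulNr oppr_lt0.
  by rewrite !mulr_gt0// ln_gt0// ltr1n.
have E n (x : R) : 0 <= x ->
    l ^+ n * (2^-1 ^+ n * x `^ p) `^ (q / p) =
    (2 `^ (- (g + p^-1) * q)) ^+ n * x `^ q.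
  move=> x0; rewrite powRM ?powR_ge0 ?exprn_ge0 ?invr_ge0// powR_exprAC ?invr_ge0//.
  rewrite mulrA -exprMn -powRrM; congr (_ ^+ _ * _ `^ _); last by field; rewrite gt_eqF.
  rewrite /l -(powR_inv1 (ler0n R 2)) -powRrM -powRD ?pnatr_eq0 ?implybT//.
  by congr (_ `^ _); field; rewrite gt_eqF.
split=> [[_ H]|H].
  have [K K0 HK] := circle_mean_lower.
  have x0 n : 0 <= 2^-1 ^+ n * F (rad n) `^ p.
    by rewrite mulr_ge0 ?exprn_ge0 ?invr_ge0 ?powR_ge0.
  have := @weighted_integral_bounded _ _
    (fun n => (K * (2^-1 ^+ n * F (rad n) `^ p)) `^ (q / p)) _ _ _ _ H.
  move=> /(_ (fun n => powR_ge0 _ _)) HB.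
  have {}HB := HB (fun n r nr => M_fin_ge p0 q0 (mulr_ge0 (ltW K0) (x0 n)) (HK n r nr)).
  move: HB; apply: (@le_bounded_psums _ _ _ (K `^ (q / p))^-1).
    by rewrite invr_ge0 powR_ge0.
  move=> n; rewrite -E ?F_ge0// ler_pdivlMl ?powR_gt0//.
  rewrite [leRHS]mulrC; rewrite (powRM _ (ltW K0)) ?x0//.
  by rewrite le_eqVlt; apply/orP; left; apply/eqP; rewrite -/l; ring.
split; first exact: f_analytic.
have [K K0 HK] := circle_mean_upper.
pose b n := 2^-1 ^+ n * F (rad n.+1) `^ p.
have b0 n : 0 <= b n by rewrite mulr_ge0 ?exprn_ge0 ?invr_ge0 ?powR_ge0.
have S0 n : 0 <= \sum_(0 <= k < n) b k by apply: sumr_ge0.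
apply: (@weighted_integral_lty _ _
  (fun n => (K * \sum_(0 <= k < n.+2) b k) `^ (q / p))).
- by move=> n; exact: powR_ge0.
- by move=> r; exact: poweR_ge0.
- move=> n r nr; apply: (M_fin_le p0 q0); first by rewrite mulr_ge0 ?S0 ?(ltW K0).
  exact: HK.
have : bounded_psums (fun n => l ^+ n * b n `^ (q / p)).
  have := geometric_shift (powR_gt0 _ _) H.
  have -> // : (fun n => l ^+ n * b n `^ (q / p)) =
    (fun n => 2 `^ (- (g + p^-1) * q) ^+ n * F (rad n.+1) `^ q).
    by apply: funext => n; rewrite E ?F_ge0.
  by apply.
move=> /(discrete_hardy _ qp0 b0); rewrite l0 l1 => /(_ isT).
move=> /(geometric_shift l0).
apply: (@le_bounded_psums _ _ _ (K `^ (q / p))); first exact: powR_ge0.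
move=> n; rewrite (powRM _ (ltW K0)) ?S0//.
by rewrite le_eqVlt; apply/orP; left; apply/eqP; rewrite -/l; ring.
Qed.

Lemma circle_mean_lower (p L : R) : 0 < p -> 0 < L ->
  (forall r theta, 0 <= r < 1 -> theta ^+ 2 * L <= (1 - r) ^+ 2 ->
    2^-1 * F r <= cabs (f (circle_pt r theta))) ->
  exists2 K, 0 < K & forall n r, dyadic_shell n r ->
  ((K * (2^-1 ^+ n * F (rad n) `^ p))%:E <=
     circle_mean p (fun theta => cabs (f (circle_pt r theta))))%E.
Proof.
move=> p0 L0 f_ge.
(* This choice gives both [d <= 1] and [d^2 L <= 1]. As [1 - r >= 2 ^ - (n + 1)] on shell [n], the
   hypothesis on [f] then applies for [theta] up to [d 2 ^ - (n + 1)]. *)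
pose d := (1 + L)^-1.
have d0 : 0 < d by rewrite invr_gt0 addr_gt0.
have d1 : d <= 1 by rewrite invf_le1 ?addr_gt0// lerDl ltW.
have d2 : d ^+ 2 * L <= 1.
  have dL : d * (1 + L) = 1 by rewrite mulVf// gt_eqF// addr_gt0.
  have dL1 : d * L <= 1 by rewrite -dL ler_wpM2l ?(ltW d0)// lerDr.
  rewrite expr2 -mulrA; apply: mulr_ile1 => //; first exact: ltW.
  exact: mulr_ge0 (ltW d0) (ltW L0).
have pi0 := pi_gt0 R.
exists (d / 2 * (2^-1 `^ p / (2 * pi))).
  apply: mulr_gt0; first exact: divr_gt0.
  by apply: divr_gt0; rewrite ?powR_gt0 ?invr_gt0// mulr_gt0.
move=> n r /[dup] nr /dyadic_shell_bounds[h1 h2 r0 r1].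
have r01 : 0 <= r < 1 by rewrite r0.
have /andP[e0 e1] := @half_exp_bounds R n.+1.
pose D := d * 2^-1 ^+ n.+1.
have D01 : 0 < D <= 1.
  by rewrite mulr_gt0//= mulr_ile1 ?(ltW d0) ?(ltW e0).
have H theta : 0 <= theta <= D -> 2^-1 * F r <= cabs (f (circle_pt r theta)).
  move=> /andP[t0 tD].
  apply: f_ge => //.
  have er : 2^-1 ^+ n.+1 <= 1 - r by move: h2; rewrite /dyadic_radius; lra.
  apply: (@le_trans _ _ ((2^-1 ^+ n.+1) ^+ 2)); last first.
    by rewrite lerXn2r ?nnegrE ?(ltW e0)// subr_ge0 ltW.
  apply: (@le_trans _ _ (D ^+ 2 * L)).
    by rewrite ler_wpM2r ?(ltW L0)// lerXn2r ?nnegrE// (le_trans t0).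
  by rewrite /D exprMn mulrAC ler_piMl ?sqr_ge0.
have w0 : 0 <= 2^-1 * F r by rewrite mulr_ge0 ?invr_ge0 ?F_ge0.
apply: le_trans (circle_mean_ge p0 w0 D01 H).
have FF : F (rad n) `^ p <= F r `^ p.
  apply: ge0_ler_powR; rewrite ?nnegrE ?(ltW p0) ?F_ge0//; apply: F_mono => //.
  by case/andP: (@dyadic_radius_bounds R n).
by rewrite lee_fin; exact: arc_constant_le (ltW d0) pi0 (F_ge0 r) FF.
Qed.

(* If theta is at distance about pi 2^-k from 0 mod 2 pi, then |f| is at most a
   constant times F(1 - 2^-(k+1)) at the point of argument theta. *)
Lemma circle_mean_upper (p C : R) : 0 < p -> 1 <= C ->
  (forall r s theta, 0 <= r -> r <= s -> s < 1 -> cabs (f (circle_pt r theta)) <= F s) ->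
  (forall r theta m, 0 <= r < 1 -> 0 < m <= 1 -> m * pi <= theta ->
    m * pi <= 2 * pi - theta -> cabs (f (circle_pt r theta)) <= C * F (1 - m)) ->
  exists2 K, 0 < K & forall n r, dyadic_shell n r ->
  (circle_mean p (fun theta => cabs (f (circle_pt r theta))) <=
   (K * \sum_(0 <= k < n.+2) 2^-1 ^+ k * F (rad k.+1) `^ p)%:E)%E.
Proof.
move=> p0 C1 f_le f_far; have pi0 := pi_gt0 R.
have C0 : 0 < C by lra.
exists (C `^ p); first exact: powR_gt0.
move=> n r /[dup] nr /dyadic_shell_bounds[h1 h2 r0 r1].
have r01 : 0 <= r < 1 by rewrite r0.
have -> : C `^ p * (\sum_(0 <= k < n.+2) 2^-1 ^+ k * F (rad k.+1) `^ p) =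
    \sum_(0 <= k < n.+2) 2^-1 ^+ k * (C * F (rad k.+1)) `^ p.
  rewrite mulr_sumr; apply: eq_bigr => k _.
  by rewrite powRM ?F_ge0 ?(ltW C0)// mulrCA.
apply: circle_mean_le => //.
- by move=> k; rewrite mulr_ge0 ?F_ge0 ?(ltW C0).
- by move=> theta; exact: cabs_ge0.
move=> theta /andP[t0 t1].
pose near k := (theta <= pi * 2^-1 ^+ k) || (2 * pi - theta <= pi * 2^-1 ^+ k).
have near0 : near 0%N.
  rewrite /near expr0 mulr1; apply/orP.
  by have [h|h] := leP theta pi; [left|right; lra].
have base : cabs (f (circle_pt r theta)) <= C * F (rad n.+2).
  apply: (@le_trans _ _ (F (rad n.+2))); last by rewrite ler_peMl ?F_ge0.
  have /andP[_ k4] := @dyadic_radius_bounds R n.+2.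
  apply: f_le => //.
  apply: (le_trans h2); rewrite /dyadic_radius lerD2l lerN2.
  by rewrite [leLHS]exprS ler_piMl ?exprn_ge0 ?invr_ge0// invf_le1// ler1n.
(* Some [k <= n + 1] has [theta] in the arc of index [k], and either [k = n + 1], where monotonicity
   in the radius is enough, or [theta] is outside the arc of index [k + 1], where [f_far] applies
   with [m = 2 ^ - (k + 1)]. *)
suff Hm m : near 0%N -> exists k, [/\ (k < m.+1)%N, near k & (k = m) \/ ~~ near k.+1].
  have [k [km nk [kE|nkS]]] := Hm n.+1 near0.
    by rewrite kE in km nk; exists n.+1; split.
  exists k; split => //.
  move: nkS; rewrite /near negb_or -!ltNge => /andP[g1 g2].
  have /andP[e0 e1] := @half_exp_bounds R k.+1.
  have m01 : 0 < (2^-1 : R) ^+ k.+1 <= 1 by rewrite e0.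
  by apply: f_far => //; rewrite mulrC ltW.
move=> n0; elim: m => [|m [k [km nk kE]]]; first by exists 0%N; split => //; left.
case: kE => [kE|kE]; last by exists k; split => //; [exact: ltnW|right].
have [nS|nS] := boolP (near m.+1); first by exists m.+1; split => //; left.
by exists k; split; [exact: ltnW|by []|right; rewrite kE].
Qed.

End HSpaceMeans.

(** * Membership of the fractional derivative in terms of moments *)

Section HSpaceCriterion.
Context {R : realType}.
Variable mu : {finite_measure set (measurableTypeR R) -> \bar R}.
Variables (alpha : R) (c : nat -> R).
Hypotheses (alpha_gt : -1 < alpha) (c0 : c 0%N = 1).
Hypothesis cS : forall n, n.+1%:R * c n.+1 = (n%:R + alpha + 1) * c n.

Let a n := c n * moment mu n.
Let f := pseries_disc a.
Notation rad := (@dyadic_radius R).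
Let F r := cabs (f r%:C).

Let summable_a : disc_summable a.
Proof. exact: disc_summable_frac_moment alpha_gt c0 cS. Qed.

Let a_ge0 n : 0 <= a n.
Proof. by rewrite mulr_ge0 ?moment_ge0// ltW// (binomial_coef_gt0 alpha_gt c0 cS). Qed.

Let F_ge0 r : 0 <= F r. Proof. exact: cabs_ge0. Qed.

Let F_mono (r s : R) : 0 <= r -> r <= s -> s < 1 -> F r <= F s.
Proof.
by move=> r0 rs s1; apply: (pseries_le_radial summable_a a_ge0) => //; rewrite cabs_real ger0_norm.
Qed.

Let M_infty (r : R) : 0 <= r < 1 -> M_ +oo%E f r = (F r)%:E.
Proof.
move=> /andP[r0 r1]; apply/eqP; rewrite eq_le; apply/andP; split.
  apply: ge_ereal_sup => _ [z /= zr <-]; rewrite lee_fin.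
  by apply: (pseries_le_radial summable_a a_ge0) => //; rewrite zr.
apply: ereal_sup_ubound; exists r%:C; last by [].
exact: (etrans (cabs_real _) (ger0_norm r0)).
Qed.

Lemma radial_psums (g q : R) : 0 < g -> 0 < q ->
  bounded_psums (fun n => (2 `^ (- g * q)) ^+ n * F (rad n) `^ q) <->
  bounded_psums (fun n => (2 `^ ((alpha + 1 - g) * q)) ^+ n * moment mu (2 ^ n)%N `^ q).
Proof.
move=> g0 q0; have a1 := alpha_gt.
have [K1 [K2 [K10 K20 cK]]] := binomial_coef_growth alpha_gt c0 cS.
(* Chosen so that [2 ^ k0 >= 2 (1 + alpha)]; since [2 ^ (n + k0) (1 - r_n) = 2 ^ k0], truncation at
   [2 ^ (n + k0)] is allowed for every [n]. *)
pose k0 := (Num.truncn (2 * (1 + alpha))).+1.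
apply: (@radial_growth_psums _ _ c (fun n => F (rad n)) alpha K1 K2 k0) => //.
- exact: moment_ge0.
- exact: moment_decreasing.
- move=> n N; apply: (pseries_radial_ge N summable_a a_ge0).
  exact: dyadic_radius_bounds.
move=> n; have /andP[r0 r1] := @dyadic_radius_bounds R n.
apply: (pseries_radial_le summable_a a_ge0) => // [|N]; first by rewrite r0.
have r01 : 0 <= rad n <= 1 by rewrite r0 ltW.
have HN : 2 * (1 + alpha) <= (2 ^ (n + k0))%:R * (1 - rad n).
  rewrite /dyadic_radius subKr natrX exprD mulrAC -exprMn mulfV// expr1n mul1r.
  apply: (le_trans (ltW (truncnS_gt _))).
  by rewrite -natrX ler_nat ltnW// ltn_expl.
apply: (le_trans (truncation_le alpha_gt c0 cS (moment_ge0 mu)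
  (@moment_decreasing _ mu) N r01 HN)).
rewrite ler_wpM2l//; apply: ler_sum_nat => k _.
by rewrite ler_piMr ?a_ge0// exprn_ile1// ltW.
Qed.

Lemma H_space_infty_moments (g q : R) : 0 < g -> 0 < q ->
  H_space +oo%E q g f <->
  bounded_psums (fun n => (2 `^ ((alpha + 1 - g) * q)) ^+ n * moment mu (2 ^ n)%N `^ q).
Proof.
move=> g0 q0; apply: iff_trans (radial_psums g0 q0).
by apply: H_space_infty_psums => //; exact: (analytic_pseries_disc summable_a).
Qed.

Lemma H_space_fin_moments (p g q : R) : 0 < p -> 0 < g -> 0 < q ->
  H_space p%:E q g f <->
  bounded_psums (fun n =>
    (2 `^ ((alpha + 1 - (g + p^-1)) * q)) ^+ n * moment mu (2 ^ n)%N `^ q).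
Proof.
move=> p0 g0 q0; have a1 := alpha_gt.
have gp0 : 0 < g + p^-1 by rewrite addr_gt0 ?invr_gt0.
apply: iff_trans (radial_psums gp0 q0).
have L0 : 0 < (3 + alpha) * (1 + alpha) by rewrite mulr_gt0//; lra.
have C1 : 1 <= 8 `^ (1 + alpha).
  rewrite -[leLHS](powRr0 8); apply: ler_powR; last by lra.
  by rewrite ler1n.
apply: H_space_fin_psums => //; first exact: (analytic_pseries_disc summable_a).
- apply: (circle_mean_lower F_ge0 F_mono p0 L0) => r theta r01 Ht.
  exact: (frac_moment_circle_ge mu alpha_gt c0 cS r01 Ht).
- apply: (circle_mean_upper F_ge0 p0 C1).
  + move=> r s theta r0 rs s1; apply: (pseries_le_radial summable_a a_ge0) => //.
    by rewrite cabs_circle_pt ger0_norm.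
  + move=> r theta m r01 m01; exact: (frac_moment_circle_le mu alpha_gt c0 cS r01 m01).
Qed.

End HSpaceCriterion.

(** * Sequence spaces *)

Section SequenceSpaces.
Context {R : realType}.
Variable mu : {finite_measure set (measurableTypeR R) -> \bar R}.

Lemma bounded_psums_blocks (u : nat -> R) : (forall n, 0 <= u n) ->
  bounded_psums (fun n => \sum_(kellogg_lo n <= k < 2 ^ n) u k) <-> bounded_psums u.
Proof.
move=> u0; split=> -[M HM]; exists M => N.
  apply: le_trans (HM N.+1); rewrite sum_kellogg_blocks.
  by rewrite [leRHS](big_cat_nat (leq0n N) (ltnW (ltn_expl N (ltnSn 1))))/= lerDl sumr_ge0.
case: N => [|N]; first by rewrite big_geq//; apply: le_trans (HM 0%N); rewrite big_geq.
by rewrite sum_kellogg_blocks.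
Qed.

Lemma kellogg_moments (e p q : R) : 0 < p -> 0 < q ->
  kellogg p q (fun n => (moment mu n * n.+1%:R `^ e)%:C) <->
  bounded_psums (fun n => (2 `^ ((e + p^-1) * q)) ^+ n * moment mu (2 ^ n)%N `^ q).
Proof.
move=> p0 q0.
apply: iff_trans (kellogg_psums e p0 q0 (moment_ge0 mu) (@moment_decreasing _ mu)).
rewrite /kellogg /mkset.
under eq_eseriesr => n _ do under eq_bigr => k _ do
  rewrite cabs_real ger0_norm ?mulr_ge0 ?moment_ge0 ?powR_ge0//.
apply: iff_trans (nneseries_lty_bounded _); last by move=> n; exact: powR_ge0.
(* The outer power [1/q] of the Kellogg norm does not change finiteness. *)
split; last by exact: poweR_lty.
by apply: lty_poweRy; rewrite invr_eq0 gt_eqF.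
Qed.

(** [ell q] is the Kellogg space with both exponents [q]: the outer exponent is [q / q = 1] and the
    blocks recombine. *)
Lemma ell_moments (e q : R) : 0 < q ->
  ell q (fun n => (n.+1%:R `^ e * moment mu n)%:C) <->
  bounded_psums (fun n => (2 `^ ((e + q^-1) * q)) ^+ n * moment mu (2 ^ n)%N `^ q).
Proof.
move=> q0.
apply: iff_trans (kellogg_psums e q0 q0 (moment_ge0 mu) (@moment_decreasing _ mu)).
have -> : (fun n => (\sum_(kellogg_lo n <= k < 2 ^ n)
      (moment mu k * k.+1%:R `^ e) `^ q) `^ (q / q)) =
    (fun n => \sum_(kellogg_lo n <= k < 2 ^ n) (moment mu k * k.+1%:R `^ e) `^ q).
  apply: funext => n; rewrite divff ?gt_eqF// powRr1//.
  by apply: sumr_ge0 => k _; exact: powR_ge0.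
have u0 n : 0 <= (moment mu n * n.+1%:R `^ e) `^ q by exact: powR_ge0.
apply: iff_trans (iff_sym (bounded_psums_blocks u0)).
apply: iff_trans (nneseries_lty_bounded u0).
rewrite /ell /mkset.
under eq_eseriesr => n _ do
  rewrite cabs_real ger0_norm ?mulr_ge0 ?moment_ge0 ?powR_ge0// mulrC.
by [].
Qed.

End SequenceSpaces.

(** * The coefficients of the fractional derivative *)

Section FractionalDerivative.
Context {R : realType}.
Variable mu : {finite_measure set (measurableTypeR R) -> \bar R}.

Definition frac_coef (alpha : R) n : R :=
  Gamma (n%:R + alpha + 1) / (n`!%:R * Gamma (alpha + 1)).

Lemma frac_coef0 (alpha : R) : -1 < alpha -> frac_coef alpha 0 = 1.
Proof.
move=> a1; rewrite /frac_coef add0r fact0 mul1r divff// gt_eqF// Gamma_gt0//; lra.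
Qed.

(** The functional equation of [Gamma] becomes the recursion which, with the value 1 at [n = 0], is
    all that the estimates know about the coefficients. *)
Lemma frac_coefS (alpha : R) n : -1 < alpha ->
  n.+1%:R * frac_coef alpha n.+1 = (n%:R + alpha + 1) * frac_coef alpha n.
Proof.
move=> a1; have n0 : 0 <= n%:R :> R by [].
have s0 : 0 < n%:R + alpha + 1 by lra.
have -> : frac_coef alpha n.+1 =
    (n%:R + alpha + 1) * Gamma (n%:R + alpha + 1) / (n.+1`!%:R * Gamma (alpha + 1)).
  rewrite /frac_coef -GammaS//; congr (Gamma _ / _).
  by rewrite -natr1; ring.
rewrite /frac_coef factS natrM; field.
have G0 : Gamma (alpha + 1) != 0 by rewrite gt_eqF// Gamma_gt0//; lra.
by rewrite G0 pnatr_eq0 -lt0n fact_gt0/= nat1r pnatr_eq0.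
Qed.

(** The constant sequence 1 satisfies the binomial recursion with [alpha = 0]. *)
Lemma disc_summable_moment : disc_summable (moment mu).
Proof.
have -> : moment mu = (fun n => (fun=> 1) n * moment mu n).
  by apply: funext => n; rewrite mul1r.
apply: (@binomial_disc_summable _ 0) => //.
- by move=> n; rewrite addr0 natr1.
- exact: moment_ge0.
- exact: moment_decreasing.
Qed.

Lemma frac_deriv_F_mu (alpha : R) :
  frac_deriv alpha (F_mu mu) = pseries_disc (fun n => frac_coef alpha n * moment mu n).
Proof.
rewrite /frac_deriv /pseries_disc; congr power_series; apply: funext => n.
rewrite (taylor_coef_pseries_disc n disc_summable_moment).
by rewrite [RHS]rmorphM.
Qed.

End FractionalDerivative.

Theorem theorem4p5 (R : realType) (q gamma alpha : R)
    (mu : {finite_measure set (measurableTypeR R) -> \bar R})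
    (hq : 0 < q) (hgamma : 0 < gamma) (halpha : -1 < alpha)
    (hmu : mu (~` `[0, 1[) = 0%E) :
  [/\ H_space +oo%E 1 gamma (frac_deriv alpha (F_mu mu)) <->
        ell 1 (fun n => (n.+1%:R `^ (alpha - gamma) * moment mu n)%:C),
      H_space +oo%E q gamma (frac_deriv alpha (F_mu mu)) <->
        ell q (fun n =>
          (n.+1%:R `^ (alpha - gamma + 1 - q^-1) * moment mu n)%:C) &
      forall p p'inv : R, 1 <= p -> p'inv = 1 - p^-1 -> alpha < gamma ->
        (H_space p%:E q gamma (frac_deriv alpha (F_mu mu)) <->
          kellogg p q (fun n =>
            (moment mu n * n.+1%:R `^ (- 2 / p + (alpha - gamma + 1)))%:C)) /\
        (kellogg p q (fun n =>
            (moment mu n * n.+1%:R `^ (- 2 / p + (alpha - gamma + 1)))%:C) <->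
          ell q (fun n =>
            (n.+1%:R `^ (alpha - gamma + p'inv - q^-1) * moment mu n)%:C))].
Proof.
rewrite frac_deriv_F_mu.
have c0 := frac_coef0 halpha; have cS n := frac_coefS n halpha.
(* This covers (i) and (ii) at once: for [s = 1] the exponent reduces to [alpha - gamma]. *)
have inf_ell s : 0 < s ->
    H_space +oo%E s gamma (pseries_disc (fun n => frac_coef alpha n * moment mu n)) <->
    ell s (fun n => (n.+1%:R `^ (alpha - gamma + 1 - s^-1) * moment mu n)%:C).
  move=> s0; apply: iff_trans (H_space_infty_moments mu halpha c0 cS hgamma s0) _.
  apply: iff_sym; apply: iff_trans (ell_moments mu _ s0) _.
  by have -> : alpha - gamma + 1 - s^-1 + s^-1 = alpha + 1 - gamma by ring.
split; last 1 first.
- move=> p p'inv p1 -> _; have p0 : 0 < p by lra.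
  have K := kellogg_moments mu (- 2 / p + (alpha - gamma + 1)) p0 hq.
  (* Adding the block contribution [1/p] to the exponent in (b), or [1/q] to that in (c), gives the
     same number [alpha + 1 - (gamma + 1/p)] that membership in [H(p, q, gamma)] requires. *)
  have E : - 2 / p + (alpha - gamma + 1) + p^-1 = alpha + 1 - (gamma + p^-1) by ring.
  rewrite E in K.
  split.
    apply: iff_trans (H_space_fin_moments mu halpha c0 cS p0 hgamma hq) _.
    exact: iff_sym.
  apply: iff_trans K _; apply: iff_sym; apply: iff_trans (ell_moments mu _ hq) _.
  by have -> : alpha - gamma + (1 - p^-1) - q^-1 + q^-1 =
    alpha + 1 - (gamma + p^-1) by ring.
- have := inf_ell 1 ltr01.
  by have -> : alpha - gamma + 1 - 1^-1 = alpha - gamma by rewrite invr1; ring.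
- exact: inf_ell.
Qed.
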